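(* Let $\mathcal A$ be a hermitian unital complex Banach algebra with continuous involution, let $n\ge1$ and $\delta=(p_1,\dots,p_n)\in\mathcal P_n(\mathcal A)$. The Stiefel bundle $$\sigma_\delta\colon\mathcal V(\delta,\mathcal A)\to\mathrm{Fl}_{\mathcal A}([\delta]),\qquad gp_n\mapsto[(gp_1g^{-1},\dots,gp_ng^{-1})]\quad(g\in\mathcal A^\times)$$ is a principal bundle with structure group $\mathcal G([\delta])$.
   Context: $\mathcal A$ has unit $\mathbf 1$, group of invertible elements $\mathcal A^\times$, and hermitian means $\sigma(a)\subset\mathbb R$ (spectrum) whenever $a=a^*$. $\mathcal P(\mathcal A)=\{p\in\mathcal A: p=p^2\}$ and $\widehat p=\mathbf 1-p$. $\mathcal P_n(\mathcal A)$ is the set of $n$-tuples $\delta=(p_1,\dots,p_n)$ of elements of $\mathcal P(\mathcal A)$ with $0=p_0<p_1<\dots<p_n<p_{n+1}=\mathbf 1$, meaning $p_jp_k=p_kp_j=p_j$ for $j\le k$ and $p_j\ne p_{j+1}$. For $p,q\in\mathcal P(\mathcal A)$, $[p]=[q]$ iff $qp=p$ and $pq=q$; $(p_j)_j\sim(q_j)_j$ in $\mathcal P_n(\mathcal A)$ iff $[p_j]=[q_j]$ for all $j$, and $[\delta]$ denotes the class of $\delta$. $\mathcal A^\times$ acts by $g\cdot[(p_1,\dots,p_n)]=[(gp_1g^{-1},\dots,gp_ng^{-1})]$, and $\mathrm{Fl}_{\mathcal A}([\delta])$ is the $\mathcal A^\times$-orbit of $[\delta]$. Put $\Delta(\delta)=\{a\in\mathcal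 A:\widehat p_jap_j=0\ (j=1,\dots,n)\}$, with group of invertible elements $\Delta(\delta)^\times$. $\mathrm{Fl}_{\mathcal A}([\delta])$ carries the complex Banach manifold structure of the homogeneous space $\mathcal A^\times/\Delta(\delta)^\times$. $\mathcal A^\times_\delta=\{g\in\mathcal A^\times: gp_j=p_j\ (j=1,\dots,n)\}=\{g\in\mathcal A^\times:gp_n=p_n\}$ is a normal subgroup of $\Delta(\delta)^\times$, and $\mathcal G([\delta])=\Delta(\delta)^\times/\mathcal A^\times_\delta$. $\mathcal V(\delta,\mathcal A)=\{(gp_1,\dots,gp_n): g\in\mathcal A^\times\}$, identified with $\{gp_n:g\in\mathcal A^\times\}$ and, as complex Banach manifold, with $\mathcal A^\times/\mathcal A^\times_\delta$ via $g\mathcal A_\delta^\times\leftrightarrow gp_n$. The right action of $\mathcal G([\delta])$ on $\mathcal V(\delta,\mathcal A)\simeq\mathcal A^\times/\mathcal A^\times_\delta$ is $(g\mathcal A^\times_\delta,a\mathcal A^\times_\delta)\mapsto ga\mathcal A^\times_\delta$. A principal $G$-bundle $\pi\colon P\to Z$ is a smooth map of Banach manifolds with a smooth free right action of the Banach-Lie group $G$ on $P$ whose orbits are the fibers of $\pi$, and such that every $z\in Z$ has an open neighborhood $V$ with a $G$-equivariant diffeomorphism $\pi^{-1}(V)\to V\times G$ over $V$. *)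

(* Defs.v *)
From HB Require Import structures.
From mathcomp Require Import all_boot all_order all_algebra.
From mathcomp Require Import all_classical all_reals all_analysis.

Set Implicit Arguments.
Unset Strict Implicit.
Unset Printing Implicit Defensive.

Import Order.TTheory GRing.Theory Num.Theory.
Import numFieldNormedType.Exports.

Local Open Scope classical_set_scope.
Local Open Scope ring_scope.

Section ProdComplete.
Variable K : numFieldType.
Variables E F : completeNormedModType K.

HB.instance Definition _ := Pointed.on (E * F)%type.

Lemma prod_cauchy_cvg (G : set_system (E * F)%type) :
  ProperFilter G -> cauchy G -> cvg G.
Proof.
move=> PG cG.
have c1 : cvg (fst @ G).
  apply: cauchy_cvg => U /= eU.
  have [|[P Q] /= [GP GQ] PQ] := cG [set z | U (z.1.1, z.2.1)].
    exists (U, setT) => /=; first by split => //; exact: filterT.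
    by move=> [[a b] [c d]] /= [Uac _]; exists ((a, c), (b, d)).
  exists (fst @` P, fst @` Q) => /=.
    by split; [apply: filterS GP|apply: filterS GQ] => x ?; exists x.
  by move=> [_ _] /= [[x Px <-] [y Qy <-]]; exact: (PQ (x, y)).
have c2 : cvg (snd @ G).
  apply: cauchy_cvg => U /= eU.
  have [|[P Q] /= [GP GQ] PQ] := cG [set z | U (z.1.2, z.2.2)].
    exists (setT, U) => /=; first by split => //; exact: filterT.
    by move=> [[a b] [c d]] /= [_ Uac]; exists ((a, c), (b, d)).
  exists (snd @` P, snd @` Q) => /=.
    by split; [apply: filterS GP|apply: filterS GQ] => x ?; exists x.
  by move=> [_ _] /= [[x Px <-] [y Qy <-]]; exact: (PQ (x, y)).
apply/cvg_ex; move/cvg_ex: c1 => [a ca]; move/cvg_ex: c2 => [b cb].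
exists (a, b) => W [[U V] /= [Ua Vb] UVW].
have GU : G (fst @^-1` U) by exact: ca.
have GV : G (snd @^-1` V) by exact: cb.
by apply: filterS (filterI GU GV) => -[x y] /= [Ux Vy]; apply: UVW.
Qed.

HB.instance Definition _ :=
  Uniform_isComplete.Build (E * F)%type prod_cauchy_cvg.
End ProdComplete.

Record closed_subspace (K : numFieldType) (E : completeNormedModType K) :=
  ClosedSubspace {
    subspace_set : set E ;
    subspace_closed : closed subspace_set ;
    subspace0 : subspace_set 0 ;
    subspaceP : forall (a : K) (x y : E),
      subspace_set x -> subspace_set y -> subspace_set (a *: x + y) }.

Section ClosedSubspace.
Variables (K : numFieldType) (E : completeNormedModType K).
Variable S : closed_subspace E.

Definition subspace_pred : pred E := fun x => `[< subspace_set S x >].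

Lemma subspace_submod : submod_closed subspace_pred.
Proof.
split; first by apply/asboolP; exact: subspace0.
by move=> a x y /asboolP Sx /asboolP Sy; apply/asboolP; exact: subspaceP.
Qed.

HB.instance Definition _ :=
  GRing.isSubmodClosed.Build K E subspace_pred subspace_submod.

Definition subspace_type : Type := {x : E | subspace_pred x}.
HB.instance Definition _ := SubChoice.on subspace_type.
HB.instance Definition _ := [SubChoice_isSubLmodule of subspace_type by <:].

Definition subspace_val (x : subspace_type) : E := val x.

Definition subspace_norm (x : subspace_type) : K := `|val x|.

Lemma subspace_normD (x y : subspace_type) :
  subspace_norm (x + y) <= subspace_norm x + subspace_norm y.
Proof. exact: ler_normD. Qed.
Lemma subspace_normZ (l : K) (x : subspace_type) :
  subspace_norm (l *: x) = `|l| * subspace_norm x.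
Proof. exact: normrZ. Qed.
Lemma subspace_norm0 (x : subspace_type) : subspace_norm x = 0 -> x = 0.
Proof. by move=> /normr0_eq0 x0; apply: val_inj. Qed.

HB.instance Definition _ := @Lmodule_isNormed.Build K subspace_type
  subspace_norm subspace_normD subspace_normZ subspace_norm0.


Lemma subspace_cauchy_cvg (F : set_system subspace_type) :
  ProperFilter F -> cauchy F -> cvg F.
Proof.
move=> PF /cauchy_ballP cF.
have cvF : cvg (subspace_val @ F).
  apply: cauchy_cvg; apply/cauchy_ballP => e e0.
  by rewrite near_map2; apply: filterS (cF e e0) => -[x y]; rewrite -!ball_normE.
move/cvg_ex: cvF => [l Fl].
have Sl : subspace_set S l.
  have FS : \forall x \near F, subspace_set S (subspace_val x).
    by apply: filterE => x; have /asboolP := valP x.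
  exact: (@closed_cvg _ _ F _ subspace_val _ (@subspace_closed _ _ S) FS l Fl).
have Pl : subspace_pred l by apply/asboolP.
apply/cvg_ex; exists (exist _ l Pl : subspace_type).
apply/cvgrPdist_lt => e e0.
by move/cvgrPdist_lt: Fl => /(_ e e0); apply: filterS.
Qed.

HB.instance Definition _ :=
  Uniform_isComplete.Build subspace_type subspace_cauchy_cvg.

End ClosedSubspace.

(** Smooth maps between Banach spaces *)

Section Smooth.
Variable K : numFieldType.

(* [Ck k U f]: [f] is [k] times differentiable on the open set [U].  The
   derivative is taken as a map of the pair (point, direction) instead of a
   map into the operator space; for k = oo this gives the same class of maps
   as the operator-norm definition. *)
Fixpoint Ck (k : nat) (E F : normedModType K) (U : set E) (f : E -> F) : Prop :=
  match k with
  | 0%N => forall x, U x -> {for x, continuous f}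
  | k'.+1 => (forall x, U x -> differentiable f x) /\
             Ck k' (U `*` [set: E]) (fun xh : E * E => 'd f (xh.1) (xh.2))
  end.

(* Smoothness is relative to the ground field [K]: over the complex numbers
   the differentials are complex linear, and smooth maps are the holomorphic
   ones. *)
Definition smooth (E F : normedModType K) (U : set E) (f : E -> F) : Prop :=
  open U /\ forall k, Ck k U f.

(* Submersions as maps that are locally, up to a diffeomorphism, projections
   U1 x U2 -> U1 of a product of open sets of Banach spaces (Lang). *)
Definition submersion (E F : completeNormedModType K) (U : set E) (f : E -> F)
    : Prop :=
  forall x, U x ->
  exists (G : completeNormedModType K) (W : set E) (U1 : set F) (U2 : set G)
         (phi : E -> F * G) (psi : F * G -> E),
    [/\ W x, W `<=` U, open U1 & open U2] /\
    [/\ smooth W phi, smooth (U1 `*` U2) psi,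
        phi @` W = U1 `*` U2,
        {in W, cancel phi psi} &
        forall u v, U1 u -> U2 v -> f (psi (u, v)) = u].

End Smooth.

(** Banach manifolds *)

Section Manifolds.
Variable K : numFieldType.

Record chart (T : Type) := Chart {
  chart_model : completeNormedModType K ;
  chart_dom : set T ;
  chart_map : T -> chart_model ;
  chart_inv : chart_model -> T }.
Arguments chart_inv {T} c _.

(* Only the values of [chart_map] on [chart_dom], and of [chart_inv] on the
   image of [chart_dom], are meaningful. *)
Definition is_chart (T : Type) (X : set T) (c : chart T) : Prop :=
  [/\ chart_dom c `<=` X,
      open (chart_map c @` chart_dom c) &
      {in chart_dom c, cancel (chart_map c) (chart_inv c)}].

(* A carrier (a subset of an ambient type) with an atlas; as in Lang, the
   topology is the one determined by the atlas, and charts may have different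
   model spaces. *)
Record manifold (T : Type) := Manifold {
  carrier : set T ;
  atlas : chart T -> Prop }.

Definition mopen (T : Type) (M : manifold T) (U : set T) : Prop :=
  U `<=` carrier M /\
  forall c, atlas M c -> open (chart_map c @` (U `&` chart_dom c)).

Definition compatible_charts (T : Type) (c d : chart T) : Prop :=
  smooth (chart_map c @` (chart_dom c `&` chart_dom d))
         (chart_map d \o chart_inv c).

Definition is_banach_manifold (T : Type) (M : manifold T) : Prop :=
  [/\ forall c, atlas M c -> is_chart (carrier M) c,
      forall x, carrier M x -> exists2 c, atlas M c & chart_dom c x,
      forall c d, atlas M c -> atlas M d -> compatible_charts c d &
      forall x y, carrier M x -> carrier M y -> x <> y ->
        exists U V, [/\ mopen M U, mopen M V, U x, V y & U `&` V = set0]].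

(* Smoothness of [f] on the open subset [D] of [M]; the openness contained in
   [smooth] says that [f] is continuous. *)
Definition msmooth_on (T T' : Type) (M : manifold T) (N : manifold T')
    (D : set T) (f : T -> T') : Prop :=
  [/\ D `<=` carrier M, f @` D `<=` carrier N &
  forall c d, atlas M c -> atlas N d ->
    smooth (chart_map c @` (D `&` chart_dom c `&` f @^-1` chart_dom d))
           (chart_map d \o f \o chart_inv c)].

Definition msmooth (T T' : Type) (M : manifold T) (N : manifold T')
    (f : T -> T') : Prop := msmooth_on M N (carrier M) f.

Definition prod_chart (T T' : Type) (c : chart T) (d : chart T') :
    chart (T * T') :=
  @Chart (T * T')%type (chart_model c * chart_model d)%type
    (chart_dom c `*` chart_dom d)
    (fun x => (chart_map c x.1, chart_map d x.2))
    (fun u => (chart_inv c u.1, chart_inv d u.2)).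

Definition prod_manifold (T T' : Type) (M : manifold T) (N : manifold T') :
    manifold (T * T') :=
  Manifold (carrier M `*` carrier N)
    (fun e => exists c d, [/\ atlas M c, atlas N d & e = prod_chart c d]).

(* [O] is an open subset of a Banach space that is a Lie group, and the fibers
   of [q] over the points of [q @` O] are the cosets of a Lie subgroup.  The
   manifold structure of the homogeneous space is the one for which [q] is a
   submersion; its maximal atlas consists of all the charts in which [q] is a
   submersion. *)
Definition quotient_manifold (E : completeNormedModType K) (T : Type)
    (O : set E) (q : E -> T) : manifold T :=
  Manifold (q @` O)
    (fun c => is_chart (q @` O) c /\
              submersion (O `&` q @^-1` chart_dom c) (chart_map c \o q)).

(** Banach-Lie groups and principal bundles *)

Record is_banach_lie_group (T : Type) (G : manifold T)
    (mul : T -> T -> T) (inv : T -> T) (one : T) : Prop := IsBanachLieGroup {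
  lie_manifold : is_banach_manifold G ;
  lie_one : carrier G one ;
  lie_mulA : forall x y z, carrier G x -> carrier G y -> carrier G z ->
    mul x (mul y z) = mul (mul x y) z ;
  lie_mul1 : forall x, carrier G x -> mul one x = x /\ mul x one = x ;
  lie_mulV : forall x, carrier G x ->
    mul (inv x) x = one /\ mul x (inv x) = one ;
  lie_smooth_mul : msmooth (prod_manifold G G) G (fun x => mul x.1 x.2) ;
  lie_smooth_inv : msmooth G G inv }.

Record is_principal_bundle (T T' S : Type)
    (P : manifold T) (Z : manifold T') (pi : T -> T')
    (G : manifold S) (mul : S -> S -> S) (inv : S -> S) (one : S)
    (act : T -> S -> T) : Prop := IsPrincipalBundle {
  pb_total : is_banach_manifold P ;
  pb_base : is_banach_manifold Z ;
  pb_group : is_banach_lie_group G mul inv one ;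
  pb_smooth_proj : msmooth P Z pi ;
  pb_smooth_act : msmooth (prod_manifold P G) P (fun x => act x.1 x.2) ;
  pb_act1 : forall x, carrier P x -> act x one = x ;
  pb_actM : forall x g h, carrier P x -> carrier G g -> carrier G h ->
    act (act x g) h = act x (mul g h) ;
  pb_free : forall x g, carrier P x -> carrier G g -> act x g = x -> g = one ;
  pb_orbits :
    [set [set act x g | g in carrier G] | x in carrier P] =
    [set carrier P `&` pi @^-1` [set z] | z in carrier Z] ;
  pb_trivial : forall z, carrier Z z ->
    exists (V : set T') (Phi : T -> T' * S) (Psi : T' * S -> T),
      let piV := carrier P `&` pi @^-1` V in
      [/\ mopen Z V, V z &
      [/\ msmooth_on P (prod_manifold Z G) piV Phi,
          msmooth_on (prod_manifold Z G) P (V `*` carrier G) Psi,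
          Phi @` piV = V `*` carrier G,
          {in piV, cancel Phi Psi} &
          (forall x, piV x -> (Phi x).1 = pi x) /\
          forall x g, piV x -> carrier G g ->
            Phi (act x g) = ((Phi x).1, mul (Phi x).2 g)]] }.

End Manifolds.

(** Banach algebras *)

(* A Banach space with a unital multiplication.  It is bundled by hand, since
   the normed modules and the algebras of the libraries have no common
   structure; the instances below make it a [unitAlgType], whose units and
   inverses are the usual two-sided ones. *)
Record banachAlgType (K : numFieldType) := BanachAlgType {
  banach_space : completeNormedModType K ;
  banach_mul : banach_space -> banach_space -> banach_space ;
  banach_one : banach_space ;
  banach_mulA : associative banach_mul ;
  banach_mul1x : left_id banach_one banach_mul ;
  banach_mulx1 : right_id banach_one banach_mul ;
  banach_mulDl : left_distributive banach_mul +%R ;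
  banach_mulDr : right_distributive banach_mul +%R ;
  banach_scaleAl : forall (l : K) x y,
    l *: banach_mul x y = banach_mul (l *: x) y ;
  banach_scaleAr : forall (l : K) x y,
    l *: banach_mul x y = banach_mul x (l *: y) ;
  banach_one_neq0 : banach_one != 0 ;
  banach_mul_norm : forall x y, `|banach_mul x y| <= `|x| * `|y| }.

Definition banach_sort (K : numFieldType) (A : banachAlgType K) : Type :=
  banach_space A.
Coercion banach_sort : banachAlgType >-> Sortclass.

Section BanachAlgebra.
Variables (K : numFieldType) (A : banachAlgType K).

HB.instance Definition _ := CompleteNormedModule.on (banach_sort A).
HB.instance Definition _ := GRing.Zmodule_isNzRing.Build (banach_sort A)
  (@banach_mulA K A) (@banach_mul1x K A) (@banach_mulx1 K A)
  (@banach_mulDl K A) (@banach_mulDr K A) (@banach_one_neq0 K A).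
HB.instance Definition _ :=
  GRing.Lmodule_isLalgebra.Build K (banach_sort A) (@banach_scaleAl K A).
HB.instance Definition _ :=
  GRing.Lalgebra_isAlgebra.Build K (banach_sort A) (@banach_scaleAr K A).

Definition banach_unit : pred A :=
  fun x => `[< exists y, y * x = 1 /\ x * y = 1 >].

Definition banach_inv (x : A) : A :=
  xget x [set y | y * x = 1 /\ x * y = 1].

Lemma banach_invP x : banach_unit x ->
  banach_inv x * x = 1 /\ x * banach_inv x = 1.
Proof.
move=> /asboolP [y yP].
exact: (@xgetI _ x [set y | y * x = 1 /\ x * y = 1] y yP).
Qed.

Lemma banach_mulVx : {in banach_unit, left_inverse 1 banach_inv *%R}.
Proof. by move=> x /banach_invP []. Qed.

Lemma banach_mulxV : {in banach_unit, right_inverse 1 banach_inv *%R}.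
Proof. by move=> x /banach_invP []. Qed.

Lemma banach_unitP (x y : A) : y * x = 1 /\ x * y = 1 -> banach_unit x.
Proof. by move=> xy; apply/asboolP; exists y. Qed.

Lemma banach_inv_out : {in [predC banach_unit], banach_inv =1 id}.
Proof.
move=> x /negP nx; rewrite /banach_inv; case: xgetP => // y _ yP.
by case: nx; exact: (@banach_unitP x y yP).
Qed.

HB.instance Definition _ := GRing.NzRing_hasMulInverse.Build (banach_sort A)
  banach_mulVx banach_mulxV banach_unitP banach_inv_out.

Lemma banach_normrM (x y : A) : `|x * y| <= `|x| * `|y|.
Proof. exact: banach_mul_norm. Qed.

End BanachAlgebra.

Record is_involution (C : numClosedFieldType) (A : banachAlgType C)
    (star : A -> A) : Prop := IsInvolution {
  starK : involutive star ;
  starP : forall (l : C) (x y : A), star (l *: x + y) = l^* *: star x + star y ;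
  starM : forall x y : A, star (x * y) = star y * star x }.

Definition spectrum (K : numFieldType) (A : banachAlgType K) (a : A) : set K :=
  [set l | a - l%:A \isn't a GRing.unit].

Definition is_hermitian (C : numClosedFieldType) (A : banachAlgType C)
    (star : A -> A) : Prop :=
  forall a : A, star a = a -> spectrum a `<=` [set l | l \is Num.real].

(** Flags of idempotents *)

Section Flags.
Variables (K : numFieldType) (A : banachAlgType K).

Section OneFlag.
Variables (n : nat) (p : 'I_n -> A).

(* The tuple (p_1, ..., p_n) is [p : 'I_n -> A] with p_j = p (j - 1);
   [flag_ext j] is p_j for 0 <= j <= n + 1, where p_0 = 0 and p_(n+1) = 1. *)
Definition flag_ext (j : nat) : A :=
  if j is j'.+1 then oapp p 1 (insub j' : option 'I_n) else 0.

Definition is_flag : Prop :=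
  [/\ forall i, p i * p i = p i,
      forall j k, (j <= k <= n.+1)%N ->
        flag_ext j * flag_ext k = flag_ext j /\
        flag_ext k * flag_ext j = flag_ext j &
      forall j, (j <= n)%N -> flag_ext j <> flag_ext j.+1].

Definition Delta : set A := [set a | forall i, (1 - p i) * a * p i = 0].

Lemma Delta_closed : closed Delta.
Proof.
have -> : Delta = \bigcap_(i in [set: 'I_n])
    ((fun a => (1 - p i) * a * p i) @^-1` [set 0]).
  by apply/seteqP; split => [a Da i _|a Da i]; [exact: Da|exact: (Da i)].
apply: closed_bigI => i _.
apply: preimage_closed; last first.
  exact/accessible_closed_set1/hausdorff_accessible/norm_hausdorff.
move=> a _; apply/cvgrPdist_lt => e e0.
pose M := `|1 - p i| * `|p i| + 1.
have M0 : 0 < M by rewrite ltr_wpDl// mulr_ge0.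
have : \forall t \near a, `|a - t| < e / M.
  by apply: (@cvgr_dist_lt _ _ _ (nbhs a) _ id a _ _ _); [exact: cvg_id|rewrite divr_gt0].
apply: filterS => t; rewrite ltr_pdivlMr// => atM.
rewrite -mulrBl -mulrBr; apply: le_lt_trans atM.
apply: le_trans (banach_normrM _ _) _.
apply: le_trans (ler_wpM2r _ (banach_normrM _ _)) _ => //.
rewrite mulrAC mulrC ler_wpM2l//; by rewrite lerDl.
Qed.

Lemma Delta0 : Delta 0.
Proof. by move=> i; rewrite mulr0 mul0r. Qed.

Lemma DeltaP (l : K) (a b : A) : Delta a -> Delta b -> Delta (l *: a + b).
Proof.
move=> Da Db i; rewrite mulrDr mulrDl Db addr0.
by rewrite -scalerAr -scalerAl Da scaler0.
Qed.

Definition Delta_subspace : closed_subspace A :=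
  ClosedSubspace Delta_closed Delta0 DeltaP.

Definition Delta_alg : completeNormedModType K := subspace_type Delta_subspace.

Definition Delta_val (a : Delta_alg) : A := subspace_val a.

Definition Delta_units : set Delta_alg :=
  [set a | Delta_val a \is a GRing.unit /\ Delta (Delta_val a)^-1].

Definition stab_units : set A :=
  [set g | g \is a GRing.unit /\ forall i, g * p i = p i].

Definition stab_coset (a : Delta_alg) : set A :=
  [set Delta_val a * h | h in stab_units].

End OneFlag.

Definition idem_equiv (p q : A) : Prop := q * p = p /\ p * q = q.

Definition flag_class (n : nat) (p : 'I_n -> A) : set ('I_n -> A) :=
  [set q | is_flag q /\ forall i, idem_equiv (p i) (q i)].

Definition flag_conj (n : nat) (p : 'I_n -> A) (g : A) : 'I_n -> A :=
  fun i => g * p i * g^-1.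

Definition units_set : set A := [set g | g \is a GRing.unit].

(* The orbit of [delta], with the manifold structure of the quotient by the
   isotropy group Delta(delta)^x. *)
Definition Fl (n : nat) (p : 'I_n -> A) : manifold K (set ('I_n -> A)) :=
  quotient_manifold units_set (fun g => flag_class (flag_conj p g)).

Definition Stiefel (n : nat) (p : 'I_n -> A) : manifold K A :=
  quotient_manifold units_set (fun g => g * flag_ext p n).

(* The elements are the cosets a A_delta^x; since A_delta^x is normal in
   Delta(delta)^x, the elementwise product and inverse of sets are the
   operations of the quotient group. *)
Definition structure_group (n : nat) (p : 'I_n -> A) : manifold K (set A) :=
  quotient_manifold (@Delta_units n p) (@stab_coset n p).

Definition set_mul (X Y : set A) : set A := [set x * y | x in X & y in Y].
Definition set_inv (X : set A) : set A := [set x^-1 | x in X].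

End Flags.

(* Main.v *)
Require Import Defs.
From HB Require Import structures.
From mathcomp Require Import all_boot all_order all_algebra.
From mathcomp Require Import all_classical all_reals all_analysis.
From mathcomp Require Import complex.
Import Order.TTheory GRing.Theory Num.Theory.
Import numFieldNormedType.Exports.
Local Open Scope classical_set_scope.
Local Open Scope ring_scope.
Set Implicit Arguments.
Unset Strict Implicit.
Unset Printing Implicit Defensive.

(** Write p_0 = 0 < p_1 < ... < p_n < p_{n+1} = 1 for the flag delta.  Each of the
three manifolds of the statement is a set q(O), where O is an open subset of a
Banach space and q is a map on O whose compositions with charts are
submersions.  Submersions have smooth local sections, so a map between two
such manifolds is smooth as soon as it lifts to a smooth map between the open
sets ([lift_msmooth]); in the same way, any two charts are compatible, q is
open, and the Hausdorff property can be checked upstairs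
([quotient_is_manifold]).  It remains to exhibit charts, and smooth lifts of
the maps of the bundle.  All these lifts are built from continuous
linear maps, the multiplication and the inversion of A; the last one is smooth
on the open set of units, by the Neumann series ([smooth_inv]).

For the Stiefel manifold and the structure group, q(g) = q(h) means that
g p_n = h p_n.  Right multiplication by p_n is a continuous linear projection,
of A in one case and of the closed subalgebra Delta(delta) in the other, and
the restriction of such a projection to an open set is a submersion; this
gives a global chart ([linear_quotient_manifold]).

For the flag manifold, put e_j = p_{j+1} - p_j (0 <= j <= n), so that the elements of A are
block matrices with respect to the e_j and Delta(delta) consists of the block
upper triangular ones.  A unit g for which every corner p_j g p_j is
invertible in p_j A p_j has a block LU factorization: with
   beta(g) = sum_j p_{j+1} (p_{j+1} g p_{j+1} + 1 - p_{j+1})^-1 e_j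
the product ell(g) = g beta(g) is 1 plus a strictly lower triangular element,
and beta(g) is upper triangular.  On the big cell, where beta(g) belongs to
the group Delta(delta)^x, this defines a smooth identification of an open set
of A^x with the product of an open set of strictly lower triangular elements
and of Delta(delta)^x; moreover ell is invariant, and beta(g)^-1 equivariant,
under right multiplication by Delta(delta)^x ([ellM], [betaM]).  Translating
the big cell by g0 gives a chart at the class of g0 ([Fl_chart_submersion]),
a smooth local section g |-> g0 ell(g0^-1 g), and the local trivialization
   g p_n |-> (class of g, class of beta(g0^-1 g)^-1)
of the Stiefel bundle ([local_triviality]). *)

(** * Differential calculus in normed spaces *)

Section Calculus.
Variable K : numFieldType.

(** Continuous linear maps, as a predicate on plain functions. *)
Definition clinear (E F : normedModType K) (f : E -> F) : Prop :=
  linear f /\ continuous f.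

(** A function with a proof of linearity, as an element of the structure
    of linear maps. *)
Definition linear_of (E F : normedModType K) (f : E -> F) (lf : linear f) :
  {linear E -> F} :=
  HB.pack f (GRing.isLinear.Build K E F *:%R f lf).

(** The differential characterized by an epsilon estimate of the remainder. *)
Lemma is_diff_near (E F : normedModType K) (f df : E -> F) (x : E) :
  clinear df ->
  (forall e, 0 < e -> \forall y \near x,
     `|f y - f x - df (y - x)| <= e * `|y - x|) ->
  differentiable f x /\ 'd f x = df :> (E -> F).
Proof.
move=> [ldf cdf] fx.
(* The remainder estimate at [x], transported to increments near 0. *)
have fE : f \o shift x = cst (f x) + linear_of ldf +o_ 0 id.
  apply/eqaddoP => e e0.
  have := fx e e0; rewrite (near_shift 0 x) /= subr0.
  apply: filterS => y /=.
  by rewrite !fctE /= addrK opprD addrA.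
have dE : 'd f x = df :> (E -> F) by exact: (diff_unique (df:=linear_of ldf)).
split=> //; apply/diff_locallyP; rewrite dE.
by split.
Qed.

Lemma diff_clinear (E F : normedModType K) (f : E -> F) (x : E) :
  clinear f -> differentiable f x /\ 'd f x = f :> (E -> F).
Proof.
move=> cf; apply: is_diff_near => // e e0; apply: nearW => y.
have [lf _] := cf; rewrite (linearB (linear_of lf) y x : f (y - x) = f y - f x).
by rewrite subrr normr0 mulr_ge0// ltW.
Qed.

Lemma diff_near_eq (E F : normedModType K) (f g : E -> F) (x : E) :
  (\forall y \near x, f y = g y) -> differentiable f x ->
  differentiable g x /\ 'd g x = 'd f x :> (E -> F).
Proof.
move=> fg df; apply: is_diff_near.
  by split; [exact: linearP|exact: diff_continuous].
move=> e e0; have gx : g x = f x by rewrite (nbhs_singleton fg).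
have /eqaddoP /(_ e e0) := diff_locally df.
rewrite [\forall x \near _, _ <= _](near_shift x) sub0r /= => fe.
near=> y; have -> : g y = f y by apply/esym; near: y.
have : `|(f \o shift x - (cst (f x) + 'd f x)) (y - x)| <= e * `|y - x|.
  by near: y.
by rewrite !fctE /= subrK gx opprD addrA.
Unshelve. all: by end_near. Qed.

Lemma Ck_continuous k (E F : normedModType K) (U : set E) (f : E -> F) x :
  Ck k U f -> U x -> {for x, continuous f}.
Proof.
case: k => [|k] /=; first by move=> h /h.
by move=> [df _] /df; exact: differentiable_continuous.
Qed.

Lemma Ck_pred k (E F : normedModType K) (U : set E) (f : E -> F) :
  Ck k.+1 U f -> Ck k U f.
Proof.
elim: k E F U f => [|k IH] E F U f; first by move=> fU x; exact: Ck_continuous fU.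
by move=> [df Cf]; split=> //; exact: IH.
Qed.

Lemma Ck_bigcup k I (E F : normedModType K) (D : set I) (W : I -> set E)
    (f : E -> F) :
  (forall i, D i -> Ck k (W i) f) -> Ck k (\bigcup_(i in D) W i) f.
Proof.
elim: k E F W f => [|k IH] E F W f CW.
  by move=> x [i Di Wx]; exact: (CW i).
split; first by move=> x [i Di Wx]; have [/(_ x Wx)] := CW i Di.
rewrite (_ : _ `*` _ = \bigcup_(i in D) (W i `*` [set: E])).
  by apply: IH => i Di; have [] := CW i Di.
by apply/seteqP; split=> [[x h] [[i Di Wx] _]|[x h] [i Di [Wx _]]];
  [exists i|split=> //; exists i].
Qed.

Lemma Ck_sub k (E F : normedModType K) (U V : set E) (f : E -> F) :
  V `<=` U -> Ck k U f -> Ck k V f.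
Proof.
elim: k E F U V f => [|k IH] E F U V f VU; first by move=> fU x /VU; exact: fU.
move=> [df Cf]; split=> [x /VU|]; first exact: df.
by apply: IH Cf => -[x h] [/VU].
Qed.

Lemma open_prodT (E F : normedModType K) (U : set E) (V : set F) :
  open U -> open V -> open (U `*` V).
Proof.
move=> oU oV; rewrite openE => -[x y] [/= Ux Vy].
by exists (U, V) => //; split; exact: open_nbhs_nbhs.
Qed.

Lemma Ck_eq k (E F : normedModType K) (U : set E) (f g : E -> F) :
  open U -> (forall x, U x -> f x = g x) -> Ck k U f -> Ck k U g.
Proof.
move=> oU fg; have nfg x : U x -> \forall y \near x, f y = g y.
  by move=> Ux; apply: filterS fg _; exact: open_nbhs_nbhs.
elim: k E F U f g oU fg nfg => [|k IH] E F U f g oU fg nfg.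
  move=> cf x Ux; rewrite /prop_for /continuous_at -fg//.
  by apply: cvg_trans (cf x Ux); exact: near_eq_cvg (nfg x Ux).
move=> [df Cf]; split=> [x Ux|].
  by have [] := diff_near_eq (nfg x Ux) (df x Ux).
have oUT : open (U `*` [set: E]) by apply: open_prodT => //; exact: openT.
have eUT : forall xh, (U `*` [set: E]) xh -> 'd f (xh.1) (xh.2) = 'd g (xh.1) (xh.2).
  by move=> [x h] [/= Ux _]; have [_ ->] := diff_near_eq (nfg x Ux) (df x Ux).
apply: IH Cf => // x UTx; apply: filterS eUT _; exact: open_nbhs_nbhs.
Qed.

Lemma clinear_comp (E F G : normedModType K) (g : F -> G) (f : E -> F) :
  clinear g -> clinear f -> clinear (g \o f).
Proof.
move=> [lg cg] [lf cf]; split=> [a x y /=|x]; first by rewrite lf lg.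
by apply: continuous_comp; [exact: cf|exact: cg].
Qed.

Lemma clinear_fst (E F : normedModType K) : clinear (@fst E F).
Proof. by split=> // x; exact: cvg_fst. Qed.

Lemma clinear_snd (E F : normedModType K) : clinear (@snd E F).
Proof. by split=> // x; exact: cvg_snd. Qed.

Lemma clinear_id (E : normedModType K) : clinear (@id E).
Proof. by split=> // x. Qed.

Lemma clinearD (E F : normedModType K) (f g : E -> F) :
  clinear f -> clinear g -> clinear (fun x => f x + g x).
Proof.
move=> [lf cf] [lg cg]; split=> [a x y|x].
  by rewrite lf lg scalerDr addrACA.
by apply: cvgD; [exact: cf|exact: cg].
Qed.

Lemma clinear_sum (E F : normedModType K) I (r : seq I) (f : I -> E -> F) :
  (forall i, clinear (f i)) -> clinear (fun x => \sum_(i <- r) f i x).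
Proof.
move=> cf; elim: r => [|i r IH].
  split=> [l x y|x]; first by rewrite !big_nil scaler0 addr0.
  by under eq_fun do rewrite big_nil; exact: cvg_cst.
by under eq_fun do rewrite big_cons; apply: clinearD.
Qed.

Lemma clinearN (E F : normedModType K) (f : E -> F) :
  clinear f -> clinear (fun x => - f x).
Proof.
move=> [lf cf]; split=> [a x y|x]; first by rewrite lf opprD scalerN.
by apply: cvgN; exact: cf.
Qed.

Lemma clinear_pair (E F G : normedModType K) (f : E -> F) (g : E -> G) :
  clinear f -> clinear g -> clinear (fun x => (f x, g x)).
Proof.
move=> [lf cf] [lg cg]; split=> [a x y|x]; first by rewrite lf lg.
by apply: cvg_pair; [exact: cf|exact: cg].
Qed.

Lemma Ck_clinear k (E F : normedModType K) (U : set E) (f : E -> F) :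
  clinear f -> Ck k U f.
Proof.
elim: k E F U f => [|k IH] E F U f cf; first by move=> x _; exact: cf.2.
split=> [x _|]; first by have [] := diff_clinear x cf.
rewrite (_ : (fun xh : E * E => _) = f \o snd).
  by apply: IH; apply: clinear_comp => //; exact: clinear_snd.
by apply/funext => -[x h] /=; rewrite (diff_clinear x cf).2.
Qed.

Lemma Ck_cst k (E F : normedModType K) (U : set E) (a : F) : Ck k U (fun=> a).
Proof.
case: k => [x _|k]; first exact: cvg_cst.
split=> [x _|]; first exact: differentiable_cst.
rewrite (_ : (fun xh : E * E => _) = fun=> 0).
  by apply: Ck_clinear; split=> [b x y|x]; [rewrite scaler0 addr0|exact: cvg_cst].
by apply/funext => -[x h] /=; rewrite -[fun=> a]/(cst a) diff_cst.
Qed.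

Lemma Ck_pair k (E F G : normedModType K) (U : set E) (f : E -> F) (g : E -> G) :
  open U -> Ck k U f -> Ck k U g -> Ck k U (fun x => (f x, g x)).
Proof.
elim: k E F G U f g => [|k IH] E F G U f g oU.
  by move=> cf cg x Ux; apply: cvg_pair; [exact: cf|exact: cg].
move=> [df Cf] [dg Cg]; split=> [x Ux|].
  by apply: differentiable_pair; [exact: df|exact: dg].
have oUT : open (U `*` [set: E]) by apply: open_prodT => //; exact: openT.
apply: Ck_eq (IH _ _ _ _ _ _ oUT Cf Cg) => // -[x h] [/= Ux _].
by rewrite diff_pair//; [exact: df|exact: dg].
Qed.

(** The chain rule: the differential of the composition is the differential
    of [g] after [(x, h) |-> (f x, 'd f x h)], so the order can be lowered by
    one in an induction over all the spaces. *)
Lemma Ck_comp k (E F G : normedModType K) (U : set E) (V : set F)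
    (f : E -> F) (g : F -> G) :
  open U -> open V -> (forall x, U x -> V (f x)) ->
  Ck k U f -> Ck k V g -> Ck k U (g \o f).
Proof.
elim: k E F G U V f g => [|k IH] E F G U V f g oU oV UV.
  move=> cf cg x Ux; apply: continuous_comp; first exact: cf.
  by apply: cg; exact: UV.
move=> Cf; have := Cf => -[df Cdf] [dg Cdg]; split=> [x Ux|].
  by apply: differentiable_comp; [exact: df|apply: dg; exact: UV].
have oT (H : normedModType K) : open [set: H] by exact: openT.
have oUT : open (U `*` [set: E]) by apply: open_prodT.
have oVT : open (V `*` [set: F]) by apply: open_prodT.
pose T (xh : E * E) := (f xh.1, 'd f (xh.1) (xh.2)).
apply: (@Ck_eq _ _ _ _ ((fun yk : F * F => 'd g (yk.1) (yk.2)) \o T)) => //.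
  move=> [x h] [/= Ux _]; by rewrite (diff_comp (df x Ux) (dg _ (UV x Ux))).
apply: (IH _ _ _ _ (V `*` [set: F])) => //.
  by move=> [x h] [/= /UV].
apply: Ck_pair => //.
apply: (IH _ _ _ _ U) => //; last exact: Ck_pred.
  by move=> x [].
by apply: Ck_clinear; exact: clinear_fst.
Qed.

End Calculus.

(** * Smooth maps *)

Section Smooth.
Variable K : numFieldType.
Implicit Types E F G : normedModType K.

Lemma smooth_open E F (U : set E) (f : E -> F) : smooth U f -> open U.
Proof. by case. Qed.

Lemma smooth_continuous E F (U : set E) (f : E -> F) x :
  smooth U f -> U x -> {for x, continuous f}.
Proof. by move=> [_ /(_ 0%N) cf] /cf. Qed.

Lemma smooth_sub E F (U V : set E) (f : E -> F) :
  open V -> V `<=` U -> smooth U f -> smooth V f.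
Proof. by move=> oV VU [oU Cf]; split=> // k; exact: Ck_sub VU (Cf k). Qed.

Lemma smooth_eq E F (U : set E) (f g : E -> F) :
  (forall x, U x -> f x = g x) -> smooth U f -> smooth U g.
Proof. by move=> fg [oU Cf]; split=> // k; exact: Ck_eq fg (Cf k). Qed.

Lemma smooth_local E F (U : set E) (f : E -> F) :
  (forall x, U x -> exists V, [/\ V x, V `<=` U & smooth V f]) -> smooth U f.
Proof.
move=> Uf.
have -> : U = \bigcup_(V in [set V | V `<=` U /\ smooth V f]) V.
  apply/seteqP; split=> [x /Uf [V [Vx VU fV]]|x [V [VU _] /VU]//].
  by exists V.
split; first by apply: bigcup_open => V [_ []].
by move=> k; apply: Ck_bigcup => V [_ [_]].
Qed.

Lemma open_preim E F (U : set E) (V : set F) (f : E -> F) :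
  open U -> open V -> (forall x, U x -> {for x, continuous f}) ->
  open (U `&` f @^-1` V).
Proof.
move=> oU oV cf; rewrite openE => x [Ux Vfx]; apply: filterI.
  exact: open_nbhs_nbhs.
by apply: (cf x Ux); exact: open_nbhs_nbhs.
Qed.

Lemma smooth_preim E F (U : set E) (V : set F) (f : E -> F) :
  smooth U f -> open V -> open (U `&` f @^-1` V).
Proof.
by move=> fU oV; apply: open_preim (smooth_open fU) oV _ => x;
  exact: smooth_continuous fU.
Qed.

Lemma smooth_comp E F G (U : set E) (V : set F) (f : E -> F) (g : F -> G) :
  (forall x, U x -> V (f x)) -> smooth V g -> smooth U f ->
  smooth U (g \o f).
Proof.
by move=> UV [oV Cg] [oU Cf]; split=> // k; exact: Ck_comp UV (Cf k) (Cg k).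
Qed.

Lemma smooth_clinear E F (U : set E) (f : E -> F) :
  open U -> clinear f -> smooth U f.
Proof. by move=> oU cf; split=> // k; exact: Ck_clinear. Qed.

Lemma smooth_clinear_comp E F G (U : set E) (f : E -> F) (g : F -> G) :
  clinear g -> smooth U f -> smooth U (g \o f).
Proof.
move=> cg; apply: (smooth_comp (V := setT)) => //.
by apply: smooth_clinear => //; exact: openT.
Qed.

Lemma smooth_cst E F (U : set E) (a : F) : open U -> smooth U (fun=> a).
Proof. by move=> oU; split=> // k; exact: Ck_cst. Qed.

Lemma smooth_id E (U : set E) : open U -> smooth U id.
Proof. by move=> oU; apply: smooth_clinear => //; exact: clinear_id. Qed.

Lemma smooth_pair E F G (U : set E) (f : E -> F) (g : E -> G) :
  smooth U f -> smooth U g -> smooth U (fun x => (f x, g x)).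
Proof. by move=> [oU Cf] [_ Cg]; split=> // k; exact: Ck_pair. Qed.

Lemma smooth_fst E F G (U : set E) (f : E -> F * G) :
  smooth U f -> smooth U (fun x => (f x).1).
Proof. by apply: (smooth_clinear_comp (f := f) (g := fst)); exact: clinear_fst. Qed.

Lemma smooth_snd E F G (U : set E) (f : E -> F * G) :
  smooth U f -> smooth U (fun x => (f x).2).
Proof. by apply: (smooth_clinear_comp (f := f) (g := snd)); exact: clinear_snd. Qed.

Lemma smoothD E F (U : set E) (f g : E -> F) :
  smooth U f -> smooth U g -> smooth U (fun x => f x + g x).
Proof.
move=> fU gU.
apply: (smooth_clinear_comp (f := fun x => (f x, g x))
  (g := fun z : F * F => z.1 + z.2)).
  by apply: clinearD; [exact: clinear_fst|exact: clinear_snd].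
exact: smooth_pair.
Qed.

Lemma smoothN E F (U : set E) (f : E -> F) :
  smooth U f -> smooth U (fun x => - f x).
Proof.
by apply: (smooth_clinear_comp (f := f) (g := -%R)); apply: clinearN; exact: clinear_id.
Qed.

Lemma smoothB E F (U : set E) (f g : E -> F) :
  smooth U f -> smooth U g -> smooth U (fun x => f x - g x).
Proof. by move=> fU gU; apply: smoothD => //; exact: smoothN. Qed.

Lemma smooth_sum E F (U : set E) I (r : seq I) (f : I -> E -> F) :
  open U -> (forall i, smooth U (f i)) ->
  smooth U (fun x => \sum_(i <- r) f i x).
Proof.
move=> oU fU; elim: r => [|i r IH].
  by apply: smooth_eq (smooth_cst 0 oU) => x _; rewrite big_nil.
by apply: smooth_eq (smoothD (fU i) IH) => x _; rewrite big_cons.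
Qed.

Lemma near_dist_le E (x : E) (e : K) : 0 < e -> \forall y \near x, `|y - x| <= e.
Proof.
move=> e0; have : \forall t \near x, `|x - t| <= e.
  by apply: (@cvgr_dist_le _ _ _ (nbhs x) _ id x _ _ _); [exact: cvg_id|].
by apply: filterS => y; rewrite distrC.
Qed.

Lemma clinear_bounded E F (f : E -> F) (M : K) :
  linear f -> (forall x, `|f x| <= M * `|x|) -> clinear f.
Proof.
move=> lf fM; split=> // x; apply/cvgrPdist_le => e e0.
have M1 : 0 < `|M| + 1 by rewrite ltr_wpDl.
have /(near_dist_le x) : 0 < e / (`|M| + 1) by rewrite divr_gt0.
apply: filterS => t; rewrite distrC ler_pdivlMr// mulrC => xt.
rewrite -(linearB (linear_of lf) x t : f (x - t) = f x - f t).
apply: le_trans (fM _) _; apply: le_trans xt.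
have [->|n0] := eqVneq (x - t) 0; first by rewrite normr0 !mulr0.
have Mr : 0 <= M.
  by have := le_trans (normr_ge0 _) (fM (x - t)); rewrite pmulr_lge0// normr_gt0.
by rewrite ler_wpM2r// ger0_norm// lerDl.
Qed.

End Smooth.

(** * Smoothness of multiplication and inversion in a Banach algebra *)

Section AlgebraCalculus.
Variables (K : numFieldType) (A : banachAlgType K).
Implicit Type E : normedModType K.

Lemma clinear_mull (a : A) : clinear (fun x : A => a * x).
Proof.
apply: (@clinear_bounded _ _ _ _ `|a|) => [k x y|x]; last exact: banach_normrM.
by rewrite mulrDr scalerAr.
Qed.

Lemma clinear_mulr (a : A) : clinear (fun x : A => x * a).
Proof.
apply: (@clinear_bounded _ _ _ _ `|a|) => [k x y|x].
  by rewrite mulrDl scalerAl.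
by rewrite mulrC; exact: banach_normrM.
Qed.

Lemma diff_mul (x : A * A) :
  differentiable (fun z : A * A => z.1 * z.2) x /\
  'd (fun z : A * A => z.1 * z.2) x =
    (fun h => x.1 * h.2 + h.1 * x.2) :> (A * A -> A).
Proof.
apply: is_diff_near.
  apply: clinearD.
    exact: (clinear_comp (clinear_mull x.1) (clinear_snd A A)).
  exact: (clinear_comp (clinear_mulr x.2) (clinear_fst A A)).
move=> e e0.
apply: filterS (near_dist_le x e0) => y yx.
rewrite [X in `|X|](_ : _ = (y - x).1 * (y - x).2); last first.
  set u := y - x; have -> : y = x + u by rewrite addrC subrK.
  rewrite /=.
  apply/eqP; rewrite mulrDl !mulrDr !subr_eq; apply/eqP.
  by rewrite [RHS](AC (1*2*1) ((4*2)*(3*1))).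
apply: le_trans (banach_normrM _ _) _; apply: ler_pM => //.
  by apply: le_trans yx; rewrite prod_normE num_le_max ?lexx// normr_real.
by rewrite prod_normE num_le_max ?lexx ?orbT// normr_real.
Qed.

(** The differential of the multiplication at [x] in direction [h] is again a
    sum of products of coordinates of [(x, h)], whence the induction. *)
Lemma Ck_mul k (U : set (A * A)) : open U ->
  Ck k U (fun z : A * A => z.1 * z.2).
Proof.
elim: k U => [|k IH] U oU.
  by move=> x _; apply: differentiable_continuous; have [] := diff_mul x.
split=> [x _|]; first exact: (diff_mul x).1.
have oT (F : normedModType K) : open [set: F] by exact: openT.
have mulT : Ck k [set: A * A] (fun z : A * A => z.1 * z.2).
  by apply: IH; exact: oT.
have C1 (f g : ((A * A) * (A * A))%type -> A) :
    clinear f -> clinear g -> Ck k (U `*` setT) (fun z => f z * g z).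
  move=> cf cg.
  apply: (Ck_comp (V := [set: A * A]) (f := fun z => (f z, g z)) _ _ _ _ mulT) => //.
    exact: open_prodT.
  apply: Ck_pair; first exact: open_prodT.
    exact: Ck_clinear.
  exact: Ck_clinear.
have cff := clinear_comp (clinear_fst A A) (clinear_fst (A * A)%type (A * A)%type).
have csf := clinear_comp (clinear_snd A A) (clinear_fst (A * A)%type (A * A)%type).
have cfs := clinear_comp (clinear_fst A A) (clinear_snd (A * A)%type (A * A)%type).
have css := clinear_comp (clinear_snd A A) (clinear_snd (A * A)%type (A * A)%type).
rewrite (_ : (fun _ => _) = (fun z => z.1 + z.2) \o
  (fun z : (A * A) * (A * A) => (z.1.1 * z.2.2, z.2.1 * z.1.2))); last first.
  by apply/funext => -[x h] /=; rewrite (diff_mul x).2.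
apply: (Ck_comp (V := [set: A * A])) => //.
- exact: open_prodT.
- by apply: Ck_pair; [exact: open_prodT|exact: C1 cff css|exact: C1 cfs csf].
- by apply: Ck_clinear; apply: clinearD; [exact: clinear_fst|exact: clinear_snd].
Qed.

Lemma smoothM E (U : set E) (f g : E -> A) :
  smooth U f -> smooth U g -> smooth U (fun x => f x * g x).
Proof.
move=> fU gU; have oT : open [set: A * A] by exact: openT.
apply: (smooth_comp (V := [set: A * A]) (f := fun x => (f x, g x))
  (g := fun z : A * A => z.1 * z.2)) => //.
  by split=> // k; exact: Ck_mul.
exact: smooth_pair.
Qed.

End AlgebraCalculus.

Section Inversion.
Variables (R : realType) (A : banachAlgType R[i]).
Implicit Type E : normedModType R[i].

(** Positive elements of [R[i]] are real, so the archimedean property of [R]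
    applies to them. *)
Lemma half_pow_lt (e : R[i]) : 0 < e -> exists n : nat, (2^-1) ^+ n < e.
Proof.
case: e => a b; rewrite ltcE /= => /andP[/eqP -> a0].
exists (Num.bound a^-1).
have -> : (2^-1 : R[i]) = ((2^-1 : R)%:C)%C by rewrite fmorphV rmorphD !rmorph1.
rewrite -rmorphXn ltcR exprVn -[ltRHS]invrK ltf_pV2 ?posrE ?invr_gt0 ?exprn_gt0//.
have := archi_boundP (ltW (_ : 0 < a^-1)); rewrite invr_gt0 => /(_ a0) /lt_le_trans; apply.
by rewrite -natrX ler_nat ltnW// ltn_expl.
Qed.

(** Partial sums of the Neumann series. *)
Definition neumann (x : A) (n : nat) : A := \sum_(i < n) x ^+ i.

Lemma normrX_le (x : A) n : `|x| <= 2^-1 -> `|x ^+ n.+1| <= 2^-1 ^+ n.+1.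
Proof.
move=> xh; elim: n => [|n IH]; first by rewrite !expr1.
rewrite exprS (exprS _ n.+1); apply: le_trans (banach_normrM _ _) _.
exact: ler_pM.
Qed.

Lemma neumann_dist (x : A) n k : `|x| <= 2^-1 ->
  `|neumann x (n.+1 + k) - neumann x n.+1| <= 2^-1 ^+ n.
Proof.
move=> xh; suff : `|neumann x (n.+1 + k) - neumann x n.+1| <=
   2^-1 ^+ n - 2^-1 ^+ (n + k).
  by move=> /le_trans; apply; rewrite gerBl exprn_ge0// invr_ge0.
elim: k => [|k IH]; first by rewrite !addn0 !subrr normr0.
rewrite addnS /neumann big_ord_recr /= addrAC.
apply: le_trans (ler_normD _ _) _.
apply: le_trans (lerD IH (_ : _ <= (2^-1) ^+ (n.+1 + k))) _.
  by rewrite addSn; exact: normrX_le.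
rewrite addnS addSn -addrA lerD2l.
have -> : (2^-1 : R[i]) ^+ (n + k) = 2^-1 ^+ (n + k).+1 + 2^-1 ^+ (n + k).+1.
  by rewrite exprS -mulrDl [2^-1 + _](_ : _ = 1) ?mul1r// [RHS](splitr 1) div1r.
by rewrite opprD addrNK.
Qed.

Lemma neumann_cvg (x : A) : `|x| <= 2^-1 -> cvg (neumann x @ \oo).
Proof.
move=> xh; apply: cauchy_cvg; apply: cauchy_exP => e /half_pow_lt [n ne].
exists (neumann x n.+1); exists n.+1 => // m /= nm.
rewrite -ball_normE /= distrC; apply: le_lt_trans ne.
by rewrite -(subnKC nm); exact: neumann_dist.
Qed.

Lemma unit_1B (x : A) : `|x| <= 2^-1 -> (1 - x) \is a GRing.unit.
Proof.
move=> xh; have /cvg_ex [y ny] := neumann_cvg xh.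
have x0 : (fun n : nat => 1 - x ^+ n) @ \oo --> (1 : A).
  apply/cvgrPdist_lt => e /half_pow_lt [n ne]; exists n.+1 => // m /= nm.
  rewrite opprB addrC subrK; apply: le_lt_trans ne.
  case: m nm => // m nm; apply: le_trans (normrX_le _ xh) _.
  by rewrite ler_wiXn2l// ?invr_ge0// ?invf_le1// ?ler1n// ltnW.
have cvgl (f : A -> A) : clinear f -> f \o neumann x @ \oo --> f y.
  by move=> [_ cf]; apply: cvg_comp ny (cf y).
have nl n : (1 - x) * neumann x n = 1 - x ^+ n.
  elim: n => [|n IH]; first by rewrite /neumann big_ord0 mulr0 subrr.
  rewrite /neumann big_ord_recr /= mulrDr -/(neumann x n) IH mulrBl mul1r -exprS.
  by rewrite addrA subrK.
have nr n : neumann x n * (1 - x) = 1 - x ^+ n.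
  elim: n => [|n IH]; first by rewrite /neumann big_ord0 mul0r subrr.
  rewrite /neumann big_ord_recr /= mulrDl -/(neumann x n) IH mulrBr mulr1 -exprSr.
  by rewrite addrA subrK.
have hA : hausdorff_space A by exact: norm_hausdorff.
apply/unitrP; exists y; split.
  apply: (cvg_unique hA (cvgl _ (clinear_mulr (1 - x)))).
  by rewrite (_ : _ \o _ = (fun n => 1 - x ^+ n)) //; apply/funext => n /=.
apply: (cvg_unique hA (cvgl _ (clinear_mull (1 - x)))).
by rewrite (_ : _ \o _ = (fun n => 1 - x ^+ n)) //; apply/funext => n /=.
Qed.

Lemma near_unit (x : A) : x \is a GRing.unit ->
  \forall y \near x, y \is a GRing.unit.
Proof.
move=> ux; have M0 : 0 < `|x^-1| + 1 by rewrite ltr_wpDl.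
have : 0 < 2^-1 / (`|x^-1| + 1) by rewrite divr_gt0// invr_gt0.
move=> /(near_dist_le x); apply: filterS => y; rewrite ler_pdivlMr// => yx.
have -> : y = x * (1 - x^-1 * (x - y)).
  by rewrite mulrBr mulr1 mulrA divrr// mul1r opprB addrC subrK.
rewrite unitrMl//; apply: unit_1B; apply: le_trans (banach_normrM _ _) _.
by apply: le_trans yx; rewrite distrC mulrC ler_wpM2l// lerDl.
Qed.

Lemma open_units : open (@units_set _ A).
Proof. by rewrite openE => x; exact: near_unit. Qed.

(** Inversion is Lipschitz at a unit: near [x], the norm of [y^-1] is at most
    twice the norm of [x^-1]. *)
Lemma inv_dist (x : A) : x \is a GRing.unit ->
  \forall y \near x, `|y^-1 - x^-1| <= (2 * `|x^-1| ^+ 2) * `|y - x|.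
Proof.
move=> ux; have M0 : 0 < `|x^-1| + 1 by rewrite ltr_wpDl.
have : 0 < 2^-1 / (`|x^-1| + 1) by rewrite divr_gt0// invr_gt0.
move=> /(near_dist_le x) ndist; near=> y.
have uy : y \is a GRing.unit by near: y; exact: near_unit.
have yx : `|y - x| * (`|x^-1| + 1) <= 2^-1.
  by rewrite -ler_pdivlMr//; near: y.
have yxV : `|y^-1 - x^-1| <= `|y^-1| * `|y - x| * `|x^-1|.
  have -> : y^-1 - x^-1 = y^-1 * (x - y) * x^-1.
    by rewrite mulrBr mulrBl mulVr// mulrK// mul1r.
  apply: le_trans (banach_normrM _ _) _; rewrite ler_wpM2r// distrC.
  exact: banach_normrM.
have yV : `|y^-1| <= 2 * `|x^-1|.
  have : `|y^-1| <= `|x^-1| + 2^-1 * `|y^-1|.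
    rewrite -[in leLHS](subrK x^-1 y^-1) addrC.
    apply: le_trans (ler_normD _ _) _; rewrite lerD2l.
    apply: le_trans yxV _; rewrite -mulrA mulrC ler_wpM2r//.
    by apply: le_trans yx; rewrite ler_wpM2l// lerDl.
  rewrite -lerBlDr -[X in X - _]mul1r -mulrBl.
  rewrite [X in X * _](_ : _ = 2^-1); last by rewrite [X in X - _](splitr 1) div1r addrK.
  by rewrite mulrC ler_pdivrMr// mulrC.
apply: le_trans yxV _.
rewrite mulrAC ler_wpM2r// expr2 mulrA ler_wpM2r//.
Unshelve. all: by end_near. Qed.

Lemma continuous_inv (x : A) : x \is a GRing.unit ->
  {for x, continuous (@GRing.inv A)}.
Proof.
move=> ux; apply/cvgrPdist_le => e e0; set M := 2 * `|x^-1| ^+ 2.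
have M0 : 0 < M + 1 by rewrite ltr_wpDl// mulr_ge0// exprn_ge0.
have : 0 < e / (M + 1) by rewrite divr_gt0.
move=> /(near_dist_le x) ne.
apply: filterS2 (inv_dist ux) ne => y yV; rewrite ler_pdivlMr// => yx.
rewrite distrC; apply: le_trans yV _; apply: le_trans yx.
by rewrite mulrC ler_wpM2l// lerDl.
Qed.

Lemma diff_inv (x : A) : x \is a GRing.unit ->
  differentiable (@GRing.inv A) x /\
  'd (@GRing.inv A) x = (fun h => - (x^-1 * h * x^-1)) :> (A -> A).
Proof.
move=> ux; apply: is_diff_near.
  by apply: clinearN; exact: (clinear_comp (clinear_mulr x^-1) (clinear_mull x^-1)).
move=> e e0; have M0 : 0 < `|x^-1| + 1 by rewrite ltr_wpDl.
have e1 : 0 < e / (`|x^-1| + 1) by rewrite divr_gt0.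
have /cvgrPdist_le /(_ _ e1) ne := continuous_inv ux.
apply: filterS2 (near_unit ux) ne => y uy; rewrite ler_pdivlMr// => xyV.
have -> : y^-1 - x^-1 - - (x^-1 * (y - x) * x^-1) =
    (x^-1 - y^-1) * (y - x) * x^-1.
  rewrite opprK mulrBl [in RHS]mulrBl [in RHS]addrC; congr (_ + _).
  by rewrite mulrBr mulrBl mulVr// mulrK// mul1r opprB.
apply: le_trans (banach_normrM _ _) _.
apply: le_trans (ler_wpM2r _ (banach_normrM _ _)) _ => //.
rewrite mulrAC ler_wpM2r//; apply: le_trans xyV.
by rewrite ler_wpM2l// lerDl.
Qed.

Lemma smooth_inv : smooth (@units_set _ A) (@GRing.inv A).
Proof.
have oU := open_units; split=> //; elim=> [|k IH].
  by move=> x; exact: continuous_inv.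
split=> [x|]; first by move=> /diff_inv [].
have oUT : open (@units_set _ A `*` [set: A]) by apply: open_prodT => //; exact: openT.
apply: (@Ck_eq _ _ _ _ _ (fun xh : A * A => - (xh.1^-1 * xh.2 * xh.1^-1))) => //.
  by move=> [x h] [/= /diff_inv [_ ->]].
have oT : open [set: A * A] by exact: openT.
have C1 : Ck k (@units_set _ A `*` [set: A]) (fun xh : A * A => xh.1^-1).
  apply: (Ck_comp (V := @units_set _ A) (f := fst) (g := @GRing.inv A)) => //.
    by move=> [x h] [].
  by apply: Ck_clinear; exact: clinear_fst.
have mulC (f g : A * A -> A) : Ck k (@units_set _ A `*` [set: A]) f ->
   Ck k (@units_set _ A `*` [set: A]) g ->
   Ck k (@units_set _ A `*` [set: A]) (fun z => f z * g z).
  move=> Cf Cg; apply: (Ck_comp (V := [set: A * A]) (f := fun z => (f z, g z))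
     (g := fun z : A * A => z.1 * z.2)) => //; first exact: Ck_pair.
  exact: Ck_mul.
apply: (Ck_comp (V := setT) (f := fun xh : A * A => xh.1^-1 * xh.2 * xh.1^-1)
  (g := -%R)) => //; first exact: openT.
  apply: (mulC _ _ _ C1); apply: (mulC _ _ C1).
  by apply: Ck_clinear; exact: clinear_snd.
by apply: Ck_clinear; apply: clinearN; exact: clinear_id.
Qed.

Lemma smoothV E (U : set E) (f : E -> A) :
  (forall x, U x -> f x \is a GRing.unit) -> smooth U f ->
  smooth U (fun x => (f x)^-1).
Proof. by move=> fU; apply: smooth_comp smooth_inv. Qed.

End Inversion.

(** * Complemented closed subspaces *)

Section Subspaces.
Variables (K : numFieldType) (E : completeNormedModType K).

Lemma clinear_val (S : closed_subspace E) : clinear (@subspace_val _ _ S).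
Proof. by apply: (@clinear_bounded _ _ _ _ 1) => // x; rewrite mul1r. Qed.

(** A map [rho] with values in a closed subspace [S], as a map into the
    Banach space [S].  When [rho] is a continuous projection, smoothness of a
    map into [S] reduces to smoothness as a map into the ambient space. *)
Definition sub_proj (S : closed_subspace E) (rho : E -> E)
    (Srho : forall x, subspace_set S (rho x)) (x : E) : subspace_type S :=
  exist _ (rho x) (asboolT (Srho x)).

Lemma clinear_sub_proj (S : closed_subspace E) (rho : E -> E)
    (Srho : forall x, subspace_set S (rho x)) :
  clinear rho -> clinear (sub_proj Srho).
Proof.
move=> [lrho crho]; split=> [a x y|x]; first by apply: val_inj; exact: lrho.
apply/cvgrPdist_lt => e e0; have /cvgrPdist_lt /(_ e e0) := crho x.
by apply: filterS.
Qed.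

Variable rho : E -> E.
Hypothesis crho : clinear rho.

Lemma fix_closed : closed [set x | rho x = x].
Proof.
have -> : [set x | rho x = x] = (fun x => rho x - x) @^-1` [set 0].
  apply/seteqP; split=> x /= => [->|/eqP]; first by rewrite subrr.
  by rewrite subr_eq0 => /eqP.
apply: preimage_closed => [x _|].
  by apply: (clinearD crho (clinearN (clinear_id E))).2.
exact/accessible_closed_set1/hausdorff_accessible/norm_hausdorff.
Qed.

Lemma fix0 : [set x | rho x = x] 0.
Proof. exact: (linear0 (linear_of crho.1)). Qed.

Lemma fixP (a : K) (x y : E) : [set x | rho x = x] x ->
  [set x | rho x = x] y -> [set x | rho x = x] (a *: x + y).
Proof. by move=> /= xx yy; rewrite crho.1 xx yy. Qed.

(** The range of a continuous linear projection [rho], as the closed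
    subspace of its fixed points. *)
Definition fix_space : closed_subspace E := ClosedSubspace fix_closed fix0 fixP.

Hypothesis rhoK : forall x, rho (rho x) = rho x.

(** The projection [rho] as a map onto its range. *)
Definition fix_proj : E -> subspace_type fix_space :=
  @sub_proj fix_space rho rhoK.

Lemma clinear_fix_proj : clinear fix_proj.
Proof. exact: clinear_sub_proj. Qed.

Lemma fix_val (y : subspace_type fix_space) : rho (subspace_val y) = subspace_val y.
Proof. by have /asboolP := valP y. Qed.

Lemma fix_projK (y : subspace_type fix_space) : fix_proj (subspace_val y) = y.
Proof. by apply: val_inj; exact: fix_val. Qed.

End Subspaces.

(** * Submersions and manifolds covered by open sets of Banach spaces *)

Section Submersions.
Variables (K : numFieldType) (E F : completeNormedModType K).

(** A submersion has a smooth local section through every point of its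
    domain. *)
Lemma submersion_section (U : set E) (f : E -> F) x : submersion U f -> U x ->
  exists V s, [/\ V (f x), smooth V s, s (f x) = x &
    forall u, V u -> U (s u) /\ f (s u) = u].
Proof.
move=> /[apply] -[G [W [U1 [U2 [phi [psi [[Wx WU oU1 oU2] [sphi spsi phiW phiK fpsi]]]]]]]].
have phi12 y : W y -> U1 (phi y).1 /\ U2 (phi y).2.
  by move=> Wy; have : (phi @` W) (phi y) by [exists y]; rewrite phiW.
have fW y : W y -> f y = (phi y).1.
  move=> Wy; have [P1 P2] := phi12 _ Wy.
  by rewrite -[in LHS](phiK y) ?inE// [phi y]surjective_pairing fpsi.
have [P1 P2] := phi12 _ Wx.
exists U1, (fun u => psi (u, (phi x).2)); split.
- by rewrite fW.
- apply: (smooth_comp (V := U1 `*` U2) (f := fun u => (u, (phi x).2)) _ spsi) => //.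
  by apply: smooth_pair; [exact: smooth_id|exact: smooth_cst].
- by rewrite fW// -surjective_pairing phiK ?inE.
move=> u U1u; rewrite fpsi//; split=> //.
have : (U1 `*` U2) (u, (phi x).2) by [].
by rewrite -phiW => -[w Ww wE]; rewrite -wE phiK ?inE//; exact: WU.
Qed.

Lemma submersion_smooth (U : set E) (f : E -> F) : submersion U f -> smooth U f.
Proof.
move=> sf; apply: smooth_local => x Ux.
have [G [W [U1 [U2 [phi [psi [[Wx WU oU1 oU2] [sphi spsi phiW phiK fpsi]]]]]]]] := sf x Ux.
exists W; split=> //; apply: smooth_eq (smooth_fst sphi) => y Wy.
have : (U1 `*` U2) (phi y) by rewrite -phiW; exists y.
move=> [P1 P2].
by rewrite -[in RHS](phiK y) ?inE// [phi y]surjective_pairing fpsi.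
Qed.

End Submersions.

Lemma submersion_eq (K : numFieldType) (E F : completeNormedModType K)
    (U : set E) (f g : E -> F) :
  (forall x, U x -> f x = g x) -> submersion U f -> submersion U g.
Proof.
move=> fg sf x Ux.
have [G [W [U1 [U2 [phi [psi [[Wx WU oU1 oU2] [sphi spsi phiW phiK fpsi]]]]]]]] := sf x Ux.
exists G, W, U1, U2, phi, psi; split; split=> // u v U1u U2v.
rewrite -fg; first exact: fpsi.
have : (U1 `*` U2) (u, v) by [].
by rewrite -phiW => -[w Ww <-]; rewrite phiK ?inE//; exact: WU.
Qed.

Section Coverings.
Variable K : numFieldType.

(** [M] is the image of the open set [O] under [q], and [q] is a submersion
    in every chart of [M].  This is what is used of the manifold structure of a
    quotient; it also holds for a product of quotients, whose atlas consists of
    product charts only. *)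
Record covered (T : Type) (M : manifold K T) (E : completeNormedModType K)
    (O : set E) (q : E -> T) : Prop := Covered {
  cov_open : open O ;
  cov_carrier : carrier M = q @` O ;
  cov_dom : forall c, atlas M c -> chart_dom c `<=` carrier M ;
  cov_inv : forall c, atlas M c ->
    {in chart_dom c, cancel (chart_map c) (@chart_inv _ _ c)} ;
  cov_subm : forall c, atlas M c ->
    submersion (O `&` q @^-1` chart_dom c) (chart_map c \o q) }.

Lemma covered_quotient (T : Type) (E : completeNormedModType K)
    (O : set E) (q : E -> T) :
  open O -> covered (quotient_manifold O q) O q.
Proof. by move=> oO; split=> // c [[]]. Qed.

Lemma submersion_prod (E1 E2 F1 F2 : completeNormedModType K)
    (U1 : set E1) (U2 : set E2) (f1 : E1 -> F1) (f2 : E2 -> F2) :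
  submersion U1 f1 -> submersion U2 f2 ->
  submersion (U1 `*` U2) (fun z => (f1 z.1, f2 z.2)).
Proof.
move=> sf1 sf2 [x1 x2] [/= Ux1 Ux2].
have [G1 [W1 [V1 [V1' [phi1 [psi1 [[Wx1 WU1 oV1 oV1'] [sphi1 spsi1 phiW1 phiK1 fpsi1]]]]]]]] :=
  sf1 x1 Ux1.
have [G2 [W2 [V2 [V2' [phi2 [psi2 [[Wx2 WU2 oV2 oV2'] [sphi2 spsi2 phiW2 phiK2 fpsi2]]]]]]]] :=
  sf2 x2 Ux2.
have oW : open (W1 `*` W2).
  by apply: open_prodT; [exact: smooth_open sphi1|exact: smooth_open sphi2].
have oV : open ((V1 `*` V2) `*` (V1' `*` V2')) by do 2?apply: open_prodT.
have s1 : smooth (W1 `*` W2) (fun z => phi1 z.1).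
  apply: (smooth_comp _ sphi1) => [z []//|].
  by apply: smooth_clinear => //; exact: clinear_fst.
have s2 : smooth (W1 `*` W2) (fun z => phi2 z.2).
  apply: (smooth_comp _ sphi2) => [z []//|].
  by apply: smooth_clinear => //; exact: clinear_snd.
have idV := smooth_id oV.
exists (G1 * G2)%type, (W1 `*` W2), (V1 `*` V2), (V1' `*` V2'),
  (fun z => (((phi1 z.1).1, (phi2 z.2).1), ((phi1 z.1).2, (phi2 z.2).2))),
  (fun w => (psi1 (w.1.1, w.2.1), psi2 (w.1.2, w.2.2))); split; split=> //.
- by move=> [y1 y2] [/= /WU1 ? /WU2 ?].
- exact: open_prodT.
- exact: open_prodT.
- by do 2?apply: smooth_pair; (exact: smooth_fst || exact: smooth_snd).
- apply: smooth_pair.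
    apply: (smooth_comp (f := fun w => (w.1.1, w.2.1)) _ spsi1) => [w [[] ? ? []]//|].
    by apply: smooth_pair; apply: smooth_fst; [exact: smooth_fst|exact: smooth_snd].
  apply: (smooth_comp (f := fun w => (w.1.2, w.2.2)) _ spsi2) => [w [[] ? ? []]//|].
  by apply: smooth_pair; apply: smooth_snd; [exact: smooth_fst|exact: smooth_snd].
- apply/seteqP; split.
    move=> _ [[y1 y2] [/= Wy1 Wy2] <-].
    have : (V1 `*` V1') (phi1 y1) by rewrite -phiW1; exists y1.
    have : (V2 `*` V2') (phi2 y2) by rewrite -phiW2; exists y2.
    by move=> [? ?] [? ?].
  move=> [[u1 u2] [v1 v2]] [[/= Vu1 Vu2] [/= Vv1 Vv2]].
  have : (V1 `*` V1') (u1, v1) by []. rewrite -phiW1 => -[y1 Wy1 y1E].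
  have : (V2 `*` V2') (u2, v2) by []. rewrite -phiW2 => -[y2 Wy2 y2E].
  by exists (y1, y2) => //=; rewrite y1E y2E.
- move=> [y1 y2]; rewrite inE => -[/= Wy1 Wy2].
  by rewrite -!surjective_pairing phiK1 ?inE// phiK2 ?inE.
- by move=> [u1 u2] [v1 v2] [/= ? ?] [/= ? ?]; rewrite fpsi1// fpsi2.
Qed.

Lemma covered_prod (T T' : Type) (M : manifold K T) (N : manifold K T')
    (E F : completeNormedModType K) (O : set E) (O' : set F) q q' :
  covered M O q -> covered N O' q' ->
  covered (prod_manifold M N) (O `*` O') (fun z => (q z.1, q' z.2)).
Proof.
move=> [oO cM dM iM sM] [oO' cN dN iN sN]; split.
- exact: open_prodT.
- rewrite /= cM cN; apply/seteqP; split.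
    by move=> [_ _] [/= [x Ox <-] [y Oy <-]]; exists (x, y).
  by move=> _ [[x y] [/= Ox Oy] <-]; split; [exists x|exists y].
- by move=> _ [c [d [Mc Nd ->]]] [x y] [/= /(dM c Mc) ? /(dN d Nd) ?].
- move=> _ [c [d [Mc Nd ->]]] [x y]; rewrite inE => -[/= cx dy].
  by rewrite iM ?inE// iN ?inE.
- move=> _ [c [d [Mc Nd ->]]].
  have := submersion_prod (sM c Mc) (sN d Nd).
  set U := (X in submersion X); set V := (X in _ -> submersion X _).
  suff -> : U = V by [].
  by apply/seteqP; split=> [[x y] [[/= ? ?] [? ?]]|[x y] [[/= ? ?] [/= ? ?]]].
Qed.

(** A map [f] is smooth when it is induced by a smooth map [F] upstairs: in
    charts, [f] is the composition of a local section, of [F], and of a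
    submersion. *)
Lemma lift_msmooth (T T' : Type) (M : manifold K T) (N : manifold K T')
    (E E' : completeNormedModType K) (O : set E) (O' : set E') q q'
    (D : set T) (f : T -> T') (F : E -> E') :
  covered M O q -> covered N O' q' -> D `<=` carrier M ->
  smooth (O `&` q @^-1` D) F ->
  (forall x, O x -> D (q x) -> O' (F x) /\ q' (F x) = f (q x)) ->
  msmooth_on M N D f.
Proof.
move=> [oO cM dM iM sM] [oO' cN dN iN sN] DM sF Ff; split=> //.
  move=> _ [x Dx <-]; have := DM x Dx; rewrite cM cN => -[g Og gx].
  by rewrite -gx in Dx *; have [? <-] := Ff g Og Dx; exists (F g).
move=> c d Mc Nd; apply: smooth_local => _ [x [[Dx cx] dx] <-].
have := DM x Dx; rewrite cM => -[g Og gx]; rewrite -gx in Dx cx dx *.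
have [|V [s [Vg sV sg sP]]] := submersion_section (x := g) (sM c Mc); first by split.
have dq' := submersion_smooth (sN d Nd).
have dF : smooth (O `&` q @^-1` D `&` F @^-1` (O' `&` q' @^-1` chart_dom d))
    ((chart_map d \o q') \o F).
  apply: (smooth_comp _ dq') => [y []//|].
  apply: (smooth_sub _ _ sF) => [|y []//].
  exact: smooth_preim sF (smooth_open dq').
have oV' := smooth_preim sV (smooth_open dF).
set V' := V `&` _ in oV'.
exists V'; split.
- split=> //; rewrite /preimage/= in sg *; rewrite sg; split=> //.
  by have [? ->] := Ff g Og Dx.
- move=> u [Vu [[Osu Dsu] [/= O'u dF'u]]]; have [[_ csu] su] := sP u Vu.
  exists (q (s u)) => //; split=> //.
  by rewrite /preimage/=; have [_ <-] := Ff _ Osu Dsu.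
apply: (@smooth_eq _ _ _ _ (((chart_map d \o q') \o F) \o s)).
  move=> u [Vu [[Osu Dsu] [/= O'u dF'u]]] /=; have [[_ csu] su] := sP u Vu.
  rewrite -[in RHS]su /= iM ?inE//.
  by have [_ ->] := Ff _ Osu Dsu.
apply: (smooth_comp _ dF) => [u []//|].
by apply: (smooth_sub _ _ sV) => // u [].
Qed.

Lemma covered_preim (T : Type) (M : manifold K T) (E : completeNormedModType K)
    (O : set E) (q : E -> T) : covered M O q -> O `&` q @^-1` carrier M = O.
Proof.
move=> cM; apply/seteqP; split=> [x []//|x Ox]; split=> //.
by rewrite /preimage/= (cov_carrier cM); exists x.
Qed.

Lemma lift_msmooth_total (T T' : Type) (M : manifold K T) (N : manifold K T')
    (E E' : completeNormedModType K) (O : set E) (O' : set E') q q'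
    (f : T -> T') (F : E -> E') :
  covered M O q -> covered N O' q' -> smooth O F ->
  (forall x, O x -> O' (F x) /\ q' (F x) = f (q x)) ->
  msmooth M N f.
Proof.
move=> cM cN sF Ff; apply: (lift_msmooth cM cN (F := F)) => // [|x Ox _].
  by rewrite (covered_preim cM).
exact: Ff.
Qed.

Section CoveredManifold.
Variables (T : Type) (M : manifold K T) (E : completeNormedModType K).
Variables (O : set E) (q : E -> T).
Hypothesis cM : covered M O q.

(** The map [q] is open. *)
Lemma mopen_image (V : set E) : open V -> V `<=` O -> mopen M (q @` V).
Proof.
move=> oV VO; split.
  by rewrite (cov_carrier cM) => _ [x /VO Ox <-]; exists x.
move=> c Mc; rewrite openE => _ [_ [[g Vg <-] cg] <-].
have [|W [s [Wg sW sg sP]]] := submersion_section (x := g) (cov_subm cM Mc).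
  by split=> //; exact: VO.
have oW := smooth_preim sW oV.
apply: (filterS (P := W `&` s @^-1` V)).
  move=> u [Wu Vsu]; have [[_ csu] su] := sP u Wu.
  by exists (q (s u)) => //; split=> //; exists (s u).
by apply: open_nbhs_nbhs; split=> //; split=> //; rewrite /preimage/= in sg *; rewrite sg.
Qed.

Lemma covered_compatible c d : atlas M c -> atlas M d -> compatible_charts c d.
Proof.
move=> Mc Md.
have [||_ _ /(_ c d Mc Md)] := lift_msmooth_total (f := id) (F := id) cM cM.
- by apply: smooth_id; exact: cov_open cM.
- by [].
rewrite /compatible_charts.
suff -> : carrier M `&` chart_dom c `&` id @^-1` chart_dom d =
  chart_dom c `&` chart_dom d by [].
apply/seteqP; split=> [x [[]]//|x [cx dx]]; split=> //; split=> //.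
exact: cov_dom cM _ Mc x cx.
Qed.

(** Since [q] is open, points with disjoint neighborhoods are obtained from
    open sets of [O] that contain no two elements with the same image. *)
Lemma covered_hausdorff :
  (forall g h, O g -> O h -> q g <> q h ->
    \forall z \near (g, h), O z.1 -> O z.2 -> q z.1 <> q z.2) ->
  forall x y, carrier M x -> carrier M y -> x <> y ->
  exists U V, [/\ mopen M U, mopen M V, U x, V y & U `&` V = set0].
Proof.
move=> hq x y; rewrite (cov_carrier cM) => -[g Og <-] [h Oh <-] gh.
have [[P Q] /= [gP hQ] PQ] := hq g h Og Oh gh.
have oI (X : set E) : open (O `&` X^°).
  by apply: openI; [exact: cov_open cM|exact: open_interior].
exists (q @` (O `&` P^°)), (q @` (O `&` Q^°)); split.
- by apply: mopen_image => // z [].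
- by apply: mopen_image => // z [].
- by exists g => //; split.
- by exists h => //; split.
apply/seteqP; split=> // _ [[g' [Og' /interior_subset Pg'] <-]].
move=> [h' [Oh' /interior_subset Qh'] /esym].
by apply: (PQ (g', h')).
Qed.

End CoveredManifold.

Lemma quotient_is_manifold (T : Type) (E : completeNormedModType K)
    (O : set E) (q : E -> T) :
  open O ->
  (forall g, O g -> exists c, [/\ is_chart (q @` O) c, chart_dom c (q g) &
     submersion (O `&` q @^-1` chart_dom c) (chart_map c \o q)]) ->
  (forall g h, O g -> O h -> q g <> q h ->
    \forall z \near (g, h), O z.1 -> O z.2 -> q z.1 <> q z.2) ->
  is_banach_manifold (quotient_manifold O q).
Proof.
move=> oO ch hq; have cM := covered_quotient q oO; split.
- by move=> c [].
- by move=> _ [g Og <-]; have [c [? ? ?]] := ch g Og; exists c.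
- by move=> c d; exact: (covered_compatible cM).
- exact: (covered_hausdorff cM hq).
Qed.

End Coverings.

(** * Quotients by the fibers of a linear projection *)

Section LinearQuotient.
Variables (K : numFieldType) (E : completeNormedModType K) (rho : E -> E).
Hypothesis crho : clinear rho.
Hypothesis rhoK : forall x, rho (rho x) = rho x.

Let fixp := fix_proj crho rhoK.

(** The product of an open set of the range and an open set of the kernel of
    [rho], chosen inside [O], is the local model. *)
Lemma submersion_fix_proj (O : set E) : open O -> submersion O fixp.
Proof.
move=> oO x Ox.
have rhoB y z : rho (y - z) = rho y - rho z by exact: (linearB (linear_of crho.1)).
(* [kap] is the complementary projection, onto the kernel of [rho]. *)
pose kap (y : E) := y - rho y.
have ckap : clinear kap.
  by apply: clinearD; [exact: clinear_id|exact: clinearN].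
have kapK y : kap (kap y) = kap y.
  by rewrite /kap !rhoB rhoK subrr subr0.
pose kfix := fix_proj ckap kapK.
have kfix0 (v : subspace_type (fix_space ckap)) : rho (subspace_val v) = 0.
  by rewrite -(fix_val v) /kap rhoB rhoK subrr.
pose psi (w : subspace_type (fix_space crho) * subspace_type (fix_space ckap)) : E :=
  subspace_val w.1 + subspace_val w.2.
have cpsi : clinear psi.
  apply: clinearD.
    exact: clinear_comp (clinear_val _) (clinear_fst _ _).
  exact: clinear_comp (clinear_val _) (clinear_snd _ _).
have psiK y : psi (fixp y, kfix y) = y by rewrite /psi /= /kap addrC subrK.
have [|[P Q] /= [xP xQ] PQ] := cpsi.2 (fixp x, kfix x) O.
  by rewrite psiK; exact: open_nbhs_nbhs.
have oPQ : open (P^° `*` Q^°) by apply: open_prodT; exact: open_interior.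
have cphi : clinear (fun y => (fixp y, kfix y)).
  by apply: clinear_pair; exact: clinear_fix_proj.
have oW : open ([set: E] `&` (fun y => (fixp y, kfix y)) @^-1` (P^° `*` Q^°)).
  by apply: open_preim => //; [exact: openT|move=> y _; exact: cphi.2].
exists (subspace_type (fix_space ckap)), (setT `&` (fun y => (fixp y, kfix y)) @^-1` (P^° `*` Q^°)),
  P^°, Q^°, (fun y => (fixp y, kfix y)), psi; split; split=> //.
- by move=> y [_ [/interior_subset Py /interior_subset Qy]]; rewrite -(psiK y); exact: PQ.
- exact: open_interior.
- exact: open_interior.
- exact: smooth_clinear.
- exact: smooth_clinear.
- apply/seteqP; split=> [_ [y [_ ?] <-]//|[u v] /= [Pu Qv]].
  have uE : fixp (psi (u, v)) = u.
    apply: val_inj => /=; rewrite /psi /=.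
    rewrite (linearD (linear_of crho.1) _ _ : rho (_ + _) = rho _ + rho _).
    by rewrite kfix0 addr0; exact: fix_val.
  have vE : kfix (psi (u, v)) = v.
    apply: val_inj; rewrite /= /kap.
    by have /(congr1 val) /= -> := uE; rewrite /psi /= addrC addKr.
  by exists (psi (u, v)); rewrite /preimage /= uE vE.
- by move=> u v _ _; apply: val_inj => /=; rewrite /psi /=;
    rewrite (linearD (linear_of crho.1) _ _ : rho (_ + _) = rho _ + rho _)
    kfix0 addr0; exact: fix_val.
Qed.

Variables (O : set E) (T : Type) (q : E -> T).
Hypothesis oO : open O.
Hypothesis qP : forall g h, O g -> O h -> q g = q h <-> rho g = rho h.

(** The global chart of the quotient of [O] by the fibers of [rho]: the class
    of [g] is sent to [rho g], by means of an arbitrary representative.  The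
    default value 0 of [xget] is not reached on the domain of the chart. *)
Definition lin_chart : chart K T :=
  @Chart K T (subspace_type (fix_space crho)) (q @` O)
    (fun t => fixp (xget 0 [set g | O g /\ q g = t]))
    (fun y => q (xget 0 [set g | O g /\ rho g = subspace_val y])).

Lemma lin_chartE g : O g -> chart_map lin_chart (q g) = fixp g.
Proof.
move=> Og /=; apply: val_inj => /=.
case: xgetP => [x _ [Ox qx]|/(_ g) []//].
by apply/qP.
Qed.

Lemma linear_quotient_manifold : is_banach_manifold (quotient_manifold O q).
Proof.
apply: quotient_is_manifold => // [g Og|g h Og Oh gh].
  exists lin_chart; split; last 2 first.
  - by exists g.
  - have -> : O `&` q @^-1` chart_dom lin_chart = O.
      by apply/seteqP; split=> [x []//|x Ox]; split=> //; exists x.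
    apply: submersion_eq (submersion_fix_proj oO) => x Ox.
    by rewrite [RHS]lin_chartE.
  split=> //; last first.
    move=> _ /set_mem [x Ox <-]; rewrite lin_chartE//=.
    case: xgetP => [y _ [Oy yx]|/(_ x) []//].
    by apply/qP.
  rewrite openE => _ [_ [x Ox <-] <-]; rewrite lin_chartE//.
  (* Near [rho x], the point [y] of the range is the value of [rho] at
     [y + (x - rho x)], which is close to [x] and so belongs to [O]. *)
  pose s (y : subspace_type (fix_space crho)) := subspace_val y + (x - rho x).
  have ss : smooth setT s.
    apply: smoothD; last by apply: smooth_cst; exact: openT.
    by apply: smooth_clinear; [exact: openT|exact: clinear_val].
  have oS := smooth_preim ss oO.
  apply: (filterS (P := setT `&` s @^-1` O)).
    move=> y [_ Osy]; exists (q (s y)); first by exists (s y).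
    rewrite lin_chartE//; apply: val_inj => /=.
    rewrite (linearD (linear_of crho.1) _ _ : rho (_ + _) = rho _ + rho _).
    rewrite (linearB (linear_of crho.1) _ _ : rho (_ - _) = rho _ - rho _).
    by rewrite rhoK subrr addr0; exact: fix_val.
  apply: open_nbhs_nbhs; split=> //; split=> //.
  by rewrite /preimage /s/= addrC subrK.
pose m (z : E * E) := rho z.1 - rho z.2.
have cm : clinear m.
  apply: clinearD; first exact: clinear_comp crho (clinear_fst _ _).
  by apply: clinearN; exact: clinear_comp crho (clinear_snd _ _).
have m0 : m (g, h) != 0.
  by rewrite /m /= subr_eq0; apply/eqP => rgh; apply: gh; apply/qP.
apply: filterS (cvgr_neq0 _ (cm.2 (g, h)) m0) => z mz Oz1 Oz2 qz.
by move/eqP: mz; apply; rewrite /m (_ : rho z.1 = rho z.2) ?subrr//; apply/qP.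
Qed.

End LinearQuotient.

(** * Block decomposition along a flag of idempotents *)

Section FlagAlgebra.
Variables (K : numFieldType) (A : banachAlgType K) (n : nat) (p : 'I_n -> A).
Hypothesis p_flag : is_flag p.

(* Here [P s] is the member of index [s <= n.+1] of the extended flag, and the
   indices [j] of the blocks [e j] range from 0 to [n]. *)
Local Notation P := (flag_ext p).
Local Notation e j := (P j.+1 - P j).
Implicit Types (a b g h x y : A) (i j k : 'I_n.+1).

(** The members [P s] of the flag, with the conventional ones [P 0 = 0] and
    [P n.+1 = 1], multiply like the minima of their indices. *)
Lemma flag_extM (s t : nat) : (s <= n.+1)%N -> (t <= n.+1)%N ->
  P s * P t = P (minn s t).
Proof.
move=> sn tn; have [_ PP _] := p_flag.
have [st|/ltnW ts] := leqP s t; first by have [] := PP s t; rewrite ?st.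
by have [] := PP t s; rewrite ?ts.
Qed.

Lemma flag_ext_last : P n.+1 = 1.
Proof. by rewrite /flag_ext insubF ?ltnn. Qed.

Lemma flag_extE (i : 'I_n) : P i.+1 = p i.
Proof. by rewrite /flag_ext /= valK. Qed.

Lemma flag_idem (s : nat) : (s <= n.+1)%N -> P s * P s = P s.
Proof. by move=> sn; rewrite flag_extM// minnn. Qed.

Lemma sum_e : \sum_(j < n.+1) e j = 1.
Proof.
rewrite -(big_mkord xpredT (fun s : nat => P s.+1 - P s)) telescope_sumr//.
by rewrite flag_ext_last; exact: subr0.
Qed.

Lemma e_flag j k : e j * P k.+1 = if (j <= k)%N then e j else 0.
Proof.
rewrite mulrBl !flag_extM// ?ltnS ?ltn_ord// ?leq_ord// ?(ltnW (ltn_ord j))//.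
  have [jk|kj] := leqP j k; first by rewrite (minn_idPl _)// (minn_idPl _)// leqW.
  by rewrite (minn_idPr _) 1?ltnW// (minn_idPr _)// subrr.
Qed.

Lemma flag_e j k : P k.+1 * e j = if (j <= k)%N then e j else 0.
Proof.
rewrite mulrBr !flag_extM// ?ltnS ?ltn_ord// ?leq_ord// ?(ltnW (ltn_ord j))//.
have [jk|kj] := leqP j k; first by rewrite (minn_idPr _)// (minn_idPr _)// leqW.
by rewrite (minn_idPl _) 1?ltnW// (minn_idPl _)// subrr.
Qed.

Lemma flagQ j : P j.+1 * (1 - P j.+1) = 0.
Proof. by rewrite mulrBr mulr1 flag_idem ?subrr// ltnS leq_ord. Qed.

Lemma Qflag j : (1 - P j.+1) * P j.+1 = 0.
Proof. by rewrite mulrBl mul1r flag_idem ?subrr// ltnS leq_ord. Qed.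

Lemma flag_idemS j : P j.+1 * P j.+1 = P j.+1.
Proof. by rewrite flag_idem// ltnS leq_ord. Qed.

(** The [n.+1] differences [e j] are orthogonal idempotents, of sum 1. *)
Lemma e_orth j k : e j * e k = if j == k then e j else 0.
Proof.
have nj : (j <= n.+1)%N by rewrite ltnW.
have nk : (k <= n.+1)%N by rewrite ltnW.
rewrite mulrBl !mulrBr !flag_extM// -(inj_eq val_inj) /=.
have [lt|gt|->] := ltngtP j k.
- have le := ltnW lt.
  rewrite (minn_idPl (lt : (j.+1 <= k)%N)) (minn_idPl (le : (j.+1 <= k.+1)%N)).
  by rewrite (minn_idPl (leqW le)) !subrr.
- have le := ltnW gt.
  rewrite (minn_idPr (gt : (k.+1 <= j)%N)) (minn_idPr (le : (k.+1 <= j.+1)%N)).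
  by rewrite (minn_idPr (leqW le)) !subrr.
- by rewrite !minnn (minn_idPr (leqnSn _)) (minn_idPl (leqnSn _)) subrr subr0.
Qed.

(** Reading off the column [k] of an element given by its columns. *)
Lemma sum_e_mul (f : 'I_n.+1 -> A) k : (\sum_j f j * e j) * e k = f k * e k.
Proof.
rewrite mulr_suml (bigD1 k)//= -mulrA e_orth eqxx big1 ?addr0// => j jk.
by rewrite -mulrA e_orth (negbTE jk) mulr0.
Qed.

Lemma e_ext a b : (forall k, a * e k = b * e k) -> a = b.
Proof.
move=> ab; rewrite -(mulr1 a) -(mulr1 b) -sum_e !mulr_sumr.
by apply: eq_bigr => k _.
Qed.

(** The members 0 and 1 of the extended flag impose no condition on the
    elements of [Delta]. *)
Lemma DeltaE a : Delta p a <-> forall s, (s <= n.+1)%N -> P s * a * P s = a * P s.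
Proof.
split=> [Da [|s] sn|aP i].
- by rewrite /= !mulr0.
- have [sn'|] := ltnP s n; last first.
    move=> ns; have -> : s = n by apply/eqP; rewrite eqn_leq ns -ltnS sn.
    by rewrite flag_ext_last mul1r.
  have := Da (Ordinal sn'); rewrite -flag_extE /= mulrBl mul1r mulrBl => /eqP.
  by rewrite subr_eq0 => /eqP/esym.
- by rewrite -flag_extE mulrBl mul1r mulrBl aP ?subrr// ltnS ltnW.
Qed.

Lemma Delta1 : Delta p 1.
Proof. by apply/DeltaE => s sn; rewrite mulr1 mul1r flag_idem. Qed.

Lemma DeltaM a b : Delta p a -> Delta p b -> Delta p (a * b).
Proof.
move=> /DeltaE Da /DeltaE Db; apply/DeltaE => s sn.
have abE : a * b * P s = a * P s * b * P s by rewrite -mulrA -Db// !mulrA.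
by rewrite -mulrA abE !mulrA Da.
Qed.

(** The projection onto the block upper triangular elements. *)
Definition pi_Delta a := \sum_(j < n.+1) P j.+1 * a * e j.

Lemma Delta_sum (f : 'I_n.+1 -> A) : Delta p (\sum_(j < n.+1) P j.+1 * f j * e j).
Proof.
move=> i; rewrite -flag_extE mulr_sumr mulr_suml big1// => j _.
have iE : (i : nat) = widen_ord (leqnSn n) i by [].
rewrite -!mulrA iE e_flag; case: ifP => [ji|_]; last by rewrite !mulr0.
rewrite !mulrA mulrBl mul1r flag_extM ?ltnS ?leq_ord//.
by rewrite (minn_idPr _)// subrr !mul0r.
Qed.

Lemma pi_DeltaP a : Delta p (pi_Delta a).
Proof. exact: (Delta_sum (fun=> a)). Qed.

Lemma pi_Delta_id a : Delta p a -> pi_Delta a = a.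
Proof.
move=> /DeltaE Da; apply: e_ext => k; rewrite /pi_Delta sum_e_mul.
have -> : e k = P k.+1 * e k by rewrite flag_e leqnn.
by rewrite !mulrA Da// ltnS leq_ord.
Qed.

Lemma pi_Delta_clinear : clinear pi_Delta.
Proof.
apply: (@clinear_sum _ _ _ _ _ (fun j x => P j.+1 * x * e j)) => j.
exact: (clinear_comp (clinear_mulr (e j)) (clinear_mull (P j.+1))).
Qed.

(** The projection onto the strictly block lower triangular elements. *)
Definition pi_N a := \sum_(j < n.+1) (1 - P j.+1) * a * e j.

Lemma pi_N_clinear : clinear pi_N.
Proof.
apply: (@clinear_sum _ _ _ _ _ (fun j x => (1 - P j.+1) * x * e j)) => j.
exact: (clinear_comp (clinear_mulr (e j)) (clinear_mull (1 - P j.+1))).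
Qed.

Lemma pi_NP a : pi_N a = a <-> forall k, P k.+1 * a * e k = 0.
Proof.
split=> [<- k|Na].
  by rewrite -mulrA /pi_N sum_e_mul !mulrA flagQ !mul0r.
by apply: e_ext => k; rewrite /pi_N sum_e_mul mulrBl mul1r [LHS]mulrBl Na subr0.
Qed.

Lemma pi_N_idem a : pi_N (pi_N a) = pi_N a.
Proof.
by apply/pi_NP => k; rewrite -mulrA /pi_N sum_e_mul !mulrA flagQ !mul0r.
Qed.

(** The group of invertible elements of [Delta], as a subset of the algebra.
    A unit of the algebra may lie in [Delta] while its inverse does not. *)
Definition Delta_inv : set A :=
  [set a | [/\ a \is a GRing.unit, Delta p a & Delta p a^-1]].

Lemma Delta_inv1 : Delta_inv 1.
Proof. by split; rewrite ?unitr1// ?invr1; exact: Delta1. Qed.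

Lemma Delta_invM a b : Delta_inv a -> Delta_inv b -> Delta_inv (a * b).
Proof.
move=> [ua Da Da'] [ub Db Db']; split; first by rewrite unitrMl.
  exact: DeltaM.
by rewrite invrM//; exact: DeltaM.
Qed.

Lemma Delta_invV a : Delta_inv a -> Delta_inv a^-1.
Proof. by move=> [ua Da Da']; split; rewrite ?unitrV ?invrK. Qed.

(** The compression of [a] to the corner of [P j.+1], completed by the
    identity on the complementary corner.  The compression is invertible in
    the corner algebra iff [corner j a] is a unit. *)
Definition corner j a := P j.+1 * a * P j.+1 + (1 - P j.+1).

Lemma flag_corner j a : P j.+1 * corner j a = P j.+1 * a * P j.+1.
Proof. by rewrite /corner mulrDr flagQ addr0 !mulrA flag_idemS. Qed.

Lemma corner1 j : corner j 1 = 1.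
Proof. by rewrite /corner mulr1 flag_idemS addrC subrK. Qed.

(** Compression to a corner is multiplicative when the right factor is upper
    triangular. *)
Lemma cornerM j g h : Delta p h -> corner j (g * h) = corner j g * corner j h.
Proof.
move=> /DeltaE Dh; rewrite {2}/corner mulrDl -!mulrA flag_corner.
have -> : (1 - P j.+1) * corner j h = 1 - P j.+1.
  rewrite /corner mulrDr !mulrA Qflag !mul0r add0r.
  by rewrite mulrBr mulr1 Qflag subr0.
rewrite /corner; congr (_ + _).
have hP : P j.+1 * (h * P j.+1) = h * P j.+1 by rewrite mulrA Dh// ltnS leq_ord.
by rewrite -!mulrA hP.
Qed.

Lemma corner_last a : corner ord_max a = a.
Proof. rewrite /corner (flag_ext_last : P (@ord_max n).+1 = 1).
by rewrite subrr addr0 mul1r mulr1. Qed.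

Lemma corner_inv j h : Delta_inv h ->
  corner j h \is a GRing.unit /\ (corner j h)^-1 = corner j h^-1.
Proof.
move=> [uh Dh Dh'].
have hV : corner j h * corner j h^-1 = 1 by rewrite -cornerM// divrr// corner1.
have Vh : corner j h^-1 * corner j h = 1 by rewrite -cornerM// mulVr// corner1.
have u : corner j h \is a GRing.unit by apply/unitrP; exists (corner j h^-1).
by split=> //; rewrite -[LHS]mulr1 -hV mulKr.
Qed.

(** An upper triangular element is invertible in [Delta] iff its corners are
    invertible; the last corner is the element itself. *)
Lemma Delta_invP b : Delta p b ->
  Delta_inv b <-> forall j, corner j b \is a GRing.unit.
Proof.
move=> Db; split=> [Db' j|ub]; first exact: (corner_inv j Db').1.
have u : b \is a GRing.unit by rewrite -(corner_last b).
split=> //; apply/DeltaE => -[|s] sn; first by rewrite /= !mulr0.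
pose j := Ordinal (sn : (s < n.+1)%N); rewrite -[s]/(j : nat).
have bP : b * (P j.+1 * (corner j b)^-1 * P j.+1) = P j.+1.
  move/DeltaE: Db => /(_ j.+1 sn) Db; rewrite !mulrA -Db -flag_corner.
  by rewrite mulrK// flag_idemS.
have bVP : b^-1 * P j.+1 = P j.+1 * (corner j b)^-1 * P j.+1.
  by rewrite -[in LHS]bP mulKr.
by rewrite -mulrA bVP !mulrA flag_idemS.
Qed.

End FlagAlgebra.

(** * Block LU factorization and the big cell *)

Section BigCell.
Variables (R : realType) (A : banachAlgType R[i]) (n : nat) (p : 'I_n -> A).
Hypothesis p_flag : is_flag p.

Local Notation P := (flag_ext p).
Local Notation e j := (P j.+1 - P j).
Implicit Types (a b g h x y : A) (j k : 'I_n.+1).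

(** The elements whose corners are all invertible; they are units, because
    the last corner is the element itself. *)
Definition corners_unit : set A := [set g | forall j, corner p j g \is a GRing.unit].

(** The inverse of the upper triangular factor of the block LU factorization. *)
Definition beta g := \sum_(j < n.+1) P j.+1 * (corner p j g)^-1 * e j.

(** The lower unitriangular factor of the block LU factorization. *)
Definition ell g := g * beta g.

(** The elements [g] for which the factorization [g = ell g * (beta g)^-1]
    exists, with [beta g] invertible in [Delta].  The condition on [beta g] is
    imposed through its corners, which makes the openness clear. *)
Definition big_cell : set A := corners_unit `&` beta @^-1` corners_unit.

Lemma smooth_corner (U : set A) j : open U -> smooth U (corner p j).
Proof.
move=> oU; apply: smoothD; last exact: smooth_cst.
by apply: smooth_clinear => //;
  exact: (clinear_comp (clinear_mulr (P j.+1)) (clinear_mull (P j.+1))).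
Qed.

Lemma open_corners_unit : open corners_unit.
Proof.
rewrite openE => g ug; apply: filter_forall => j.
have sc := smooth_corner j (@openT A).
have oj := smooth_preim sc (@open_units R A).
apply: (filterS (P := setT `&` corner p j @^-1` @units_set _ A)); first by move=> x [].
apply: open_nbhs_nbhs; split=> //; split=> //; exact: ug.
Qed.

Lemma smooth_beta : smooth corners_unit beta.
Proof.
have oC := open_corners_unit; apply: smooth_sum => // j.
apply: smoothM; last exact: smooth_cst.
apply: smoothM; first exact: smooth_cst.
by apply: smoothV; [move=> x; exact|exact: smooth_corner].
Qed.

Lemma open_big_cell : open big_cell.
Proof. exact: smooth_preim smooth_beta open_corners_unit. Qed.

Lemma smooth_beta_cell : smooth big_cell beta.
Proof. by apply: smooth_sub smooth_beta; [exact: open_big_cell|move=> x []]. Qed.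

Lemma smooth_ell : smooth big_cell ell.
Proof.
by apply: smoothM smooth_beta_cell; apply: smooth_id; exact: open_big_cell.
Qed.

Lemma corners_unit_unit g : corners_unit g -> g \is a GRing.unit.
Proof. by move=> ug; rewrite -[g](corner_last p). Qed.

Lemma beta_Delta g : Delta p (beta g).
Proof. exact: Delta_sum. Qed.

Lemma beta_inv g : big_cell g -> Delta_inv p (beta g).
Proof. by move=> [_ ub]; apply/Delta_invP => //; exact: beta_Delta. Qed.

Lemma betaM g h : corners_unit g -> Delta_inv p h -> beta (g * h) = h^-1 * beta g.
Proof.
move=> ug hD; have [uh Dh Dh'] := hD; apply: (e_ext (p := p)) => k.
rewrite -mulrA /beta !(sum_e_mul p_flag) cornerM//.
have [uc ucE] := corner_inv p_flag k hD.
rewrite invrM// ucE !mulrA; congr (_ * _ * _).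
rewrite flag_corner//; move/DeltaE: Dh' => -> //; by rewrite ltnS leq_ord.
Qed.

Lemma corners_unitM g h : corners_unit g -> Delta_inv p h -> corners_unit (g * h).
Proof.
move=> ug hD j; have [uh Dh Dh'] := hD; rewrite cornerM// unitrMl ?ug//.
by have [] := corner_inv p_flag j hD.
Qed.

Lemma big_cellM g h : big_cell g -> Delta_inv p h -> big_cell (g * h).
Proof.
move=> gW hD; have [ug _] := gW; split; first exact: corners_unitM.
rewrite /preimage /= betaM//.
have Dx : Delta_inv p (h^-1 * beta g).
  by apply: Delta_invM => //; [exact: Delta_invV|exact: beta_inv].
by apply/Delta_invP => //; case: Dx.
Qed.

Lemma ellM g h : big_cell g -> Delta_inv p h -> ell (g * h) = ell g.
Proof.
move=> [ug _] hD; have [uh _ _] := hD.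
by rewrite /ell betaM// -!mulrA mulVKr.
Qed.

Lemma big_cell_ell g : big_cell g -> big_cell (ell g).
Proof. by move=> gW; apply: big_cellM => //; exact: beta_inv. Qed.

(** [ell g] is 1 plus a strictly lower triangular element. *)
Lemma ell_N g : big_cell g -> pi_N p (ell g - 1) = ell g - 1.
Proof.
move=> [ug _]; apply/(pi_NP p_flag) => k.
rewrite (mulrBr (P k.+1)) mulr1 (mulrBl (e k)) /ell -!mulrA /beta (sum_e_mul p_flag).
rewrite !mulrA -flag_corner// mulrK//.
by rewrite subrr.
Qed.

(** A lower unitriangular element is its own lower factor. *)
Lemma beta_N x : pi_N p x = x -> corners_unit (1 + x) -> beta (1 + x) = 1.
Proof.
move=> /(pi_NP p_flag) Nx ux; apply: (e_ext (p := p)) => k.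
rewrite mul1r /beta (sum_e_mul p_flag).
have Pe : P k.+1 * e k = e k by rewrite flag_e// leqnn.
have ce : corner p k (1 + x) * e k = e k.
  rewrite /corner mulrDl -mulrA Pe (mulrDr (P k.+1)) mulrDl mulr1 Pe Nx addr0.
  by rewrite (mulrBl (e k)) mul1r Pe subrr addr0.
by rewrite -mulrA -[in LHS]ce mulKr.
Qed.

(** Uniqueness of the block LU factorization. *)
Lemma ell_N_Delta x b : pi_N p x = x -> big_cell (1 + x) -> Delta_inv p b ->
  ell ((1 + x) * b) = 1 + x /\ (beta ((1 + x) * b))^-1 = b.
Proof.
move=> Nx xW bD; have [ux _] := xW; have [ub _ _] := bD.
rewrite ellM// /ell betaM// beta_N//.
by rewrite !mulr1 invrK.
Qed.

Lemma big_cell1 : big_cell 1.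
Proof.
have c1 : corners_unit 1 by move=> j; rewrite corner1// unitr1.
have N0 : pi_N p 0 = 0 by apply/(pi_NP p_flag) => k; rewrite mulr0 mul0r.
have b1 : beta 1 = 1 by have := beta_N N0; rewrite addr0; apply.
by split=> //; rewrite /preimage /= b1.
Qed.

Lemma Delta_unitsE (a : Delta_alg p) :
  Delta_units a <-> Delta_inv p (Delta_val a).
Proof.
split=> [[ua Da]|[ua _ Da]]; last by split.
by split=> //; have /asboolP := valP a.
Qed.

Lemma DeltaP_val (a : Delta_alg p) : Delta p (Delta_val a).
Proof. by have /asboolP := valP a. Qed.

Lemma open_Delta_units : open (@Delta_units _ _ _ p).
Proof.
have sv : smooth [set: Delta_alg p] (@Delta_val _ _ _ p).
  by apply: smooth_clinear; [exact: openT|exact: clinear_val].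
rewrite (_ : @Delta_units _ _ _ p = setT `&` @Delta_val _ _ _ p @^-1` corners_unit).
  exact: smooth_preim sv open_corners_unit.
apply/seteqP; split=> [a /Delta_unitsE aD|a [_ aC]].
  by split=> //; apply/Delta_invP => //; exact: DeltaP_val.
by apply/Delta_unitsE/Delta_invP => //; exact: DeltaP_val.
Qed.

(** The projection onto the upper triangular elements, as a map into the
    Banach space [Delta]. *)
Definition to_Delta : A -> Delta_alg p :=
  @sub_proj _ _ (Delta_subspace p) (pi_Delta p) (pi_DeltaP p_flag).

Lemma clinear_to_Delta : clinear to_Delta.
Proof. by apply: clinear_sub_proj; exact: pi_Delta_clinear. Qed.

Lemma to_DeltaK a : Delta p a -> Delta_val (to_Delta a) = a.
Proof. exact: pi_Delta_id. Qed.

Lemma Delta_valK (a : Delta_alg p) : to_Delta (Delta_val a) = a.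
Proof. by apply: val_inj; apply: pi_Delta_id => //; exact: DeltaP_val. Qed.

(** The orbit map onto the flag manifold. *)
Definition Fl_map g := flag_class (flag_conj p g).

Lemma flag_ext_conj g : g \is a GRing.unit -> forall s, (s <= n.+1)%N ->
  flag_ext (flag_conj p g) s = g * P s * g^-1.
Proof.
move=> ug [|s] sn; first by rewrite /= mulr0 mul0r.
rewrite /flag_ext; case: insubP => [i _ _|_] //=.
by rewrite mulr1 divrr.
Qed.

Lemma flag_conj_flag g : g \is a GRing.unit -> is_flag (flag_conj p g).
Proof.
move=> ug; have [pp PP Pn] := p_flag.
have cM a b : g * a * g^-1 * (g * b * g^-1) = g * (a * b) * g^-1.
  by rewrite !mulrA mulrVK.
split=> [i|j k|j jn].
- by rewrite /flag_conj cM pp.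
- move=> /andP[jk kn]; rewrite !flag_ext_conj ?(leq_trans jk)// !cM.
  by have [] := PP j k; rewrite ?jk// => -> ->.
rewrite !flag_ext_conj ?(leqW jn)// => /(congr1 (fun x => g^-1 * x * g)).
by rewrite -!mulrA !mulKr// mulVr// !mulr1; exact: Pn.
Qed.

(** The isotropy group of the class of [delta] is the group of invertible
    elements of [Delta]. *)
Lemma Fl_mapP g h : g \is a GRing.unit -> h \is a GRing.unit ->
  Fl_map g = Fl_map h <-> Delta_inv p (g^-1 * h).
Proof.
move=> ug uh.
pose c i := g * p i * g^-1; pose d i := h * p i * h^-1.
have pp i : p i * p i = p i by have [] := p_flag.
have cc i : c i * c i = c i by rewrite /c !mulrA mulrVK// -(mulrA g) pp.
have dd i : d i * d i = d i by rewrite /d !mulrA mulrVK// -(mulrA h) pp.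
(* The equivalence of the conjugates [c i] and [d i] is the vanishing of the
   lower left blocks of [g^-1 * h] and of its inverse. *)
have key i : idem_equiv (c i) (d i) <->
   ((1 - p i) * (g^-1 * h) * p i = 0 /\ (1 - p i) * (h^-1 * g) * p i = 0).
  have E x y : x \is a GRing.unit -> y \is a GRing.unit ->
    (x * p i * x^-1 * (y * p i * y^-1) = y * p i * y^-1 <->
     (1 - p i) * (x^-1 * y) * p i = 0).
    move=> ux uy; split=> [H|/eqP].
      apply/eqP; rewrite !mulrBl mul1r subr_eq0; apply/eqP.
      have := congr1 (fun z => x^-1 * z * y) H.
      by rewrite -!mulrA !mulKr// mulVr// !mulr1 => ->.
    rewrite !mulrBl mul1r subr_eq0 => /eqP H.
    have -> : x * p i * x^-1 * (y * p i * y^-1) =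
        x * (p i * (x^-1 * y) * p i) * y^-1 by rewrite !mulrA.
    by rewrite -H !mulrA divrr// mul1r.
  by split=> -[H1 H2]; split; apply/E.
have sym : (forall i, idem_equiv (c i) (d i)) <-> Delta_inv p (g^-1 * h).
  have ugh : g^-1 * h \is a GRing.unit by rewrite unitrMl ?unitrV.
  split=> [cd|[_ D1 D2] i].
    split=> // i; first by have /key [] := cd i.
    by rewrite invrM ?unitrV// invrK; have /key [] := cd i.
  apply/key; split; first exact: D1.
  by have := D2 i; rewrite invrM ?unitrV// invrK.
rewrite -sym; split=> [gh i|cd].
  have : Fl_map h (flag_conj p h).
    by split=> [|j]; [exact: flag_conj_flag|split; exact: dd].
  by rewrite -gh => -[_ /(_ i)].
apply/seteqP; split=> q [fq qi]; split=> // i.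
  have [a1 a2] := cd i; have [b1 b2] : idem_equiv (c i) (q i) := qi i.
  by split; [rewrite -[LHS]/(q i * d i) -a2 mulrA b1
            |rewrite -[LHS]/(d i * q i) -[in LHS]b2 mulrA a1].
have [a1 a2] := cd i; have [b1 b2] : idem_equiv (d i) (q i) := qi i.
by split; [rewrite -[LHS]/(q i * c i) -a1 mulrA b1
          |rewrite -[LHS]/(c i * q i) -[in LHS]b2 mulrA a2].
Qed.

End BigCell.

(** * The flag manifold *)

Section FlagManifold.
Variables (R : realType) (A : banachAlgType R[i]) (n : nat) (p : 'I_n -> A).
Hypothesis p_flag : is_flag p.

Local Notation unitsA := (@units_set _ A).
Local Notation qF := (Fl_map p).

(** The translate of the big cell by [g0]. *)
Definition cell_at (g0 : A) : set A := [set g | big_cell p (g0^-1 * g)].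

Lemma cell_at_unit g0 g : g0 \is a GRing.unit -> cell_at g0 g -> g \is a GRing.unit.
Proof.
by move=> u0 [/corners_unit_unit]; rewrite unitrMr ?unitrV.
Qed.

Lemma smooth_cell_at g0 (F : normedModType R[i]) (f : A -> F) :
  smooth (big_cell p) f -> smooth (cell_at g0) (fun g => f (g0^-1 * g)).
Proof.
move=> sf; have sm : smooth [set: A] (fun g => g0^-1 * g).
  by apply: smooth_clinear; [exact: openT|exact: clinear_mull].
have oC := smooth_preim sm (smooth_open sf).
have -> : cell_at g0 = setT `&` (fun g => g0^-1 * g) @^-1` big_cell p.
  by apply/seteqP; split=> [x|x []].
apply: (smooth_comp _ sf) => [x []//|].
by apply: (smooth_sub _ _ sm).
Qed.

Lemma open_cell_at g0 : open (cell_at g0).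
Proof. by apply: smooth_open (smooth_cell_at g0 (smooth_ell p)). Qed.

Lemma cell_at_class g0 g h : g0 \is a GRing.unit -> cell_at g0 g ->
  h \is a GRing.unit -> qF g = qF h ->
  exists2 k, Delta_inv p k & h = g * k.
Proof.
move=> u0 gW uh; have ug := cell_at_unit u0 gW.
by move=> /(Fl_mapP p_flag ug uh) gh; exists (g^-1 * h); rewrite ?mulVKr.
Qed.

(** The lower factor is a representative of the same class. *)
Lemma Fl_map_ell g0 g : g0 \is a GRing.unit -> cell_at g0 g ->
  qF (g0 * ell p (g0^-1 * g)) = qF g.
Proof.
move=> u0 gW; have ug := cell_at_unit u0 gW.
rewrite /ell !mulrA mulrV// mul1r.
have bD := beta_inv p_flag gW; have [ub _ _] := bD.
apply/Fl_mapP => //; first by rewrite unitrMl.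
rewrite invrM// -mulrA mulVr// mulr1; exact: Delta_invV.
Qed.

Local Notation Nspace := (fix_space (pi_N_clinear p)).
Let toN := fix_proj (pi_N_clinear p) (pi_N_idem p_flag).

(** The chart at the class of [g0]: the class of [g] is sent to the strictly
    lower triangular part of [g0^-1 g] in its block LU factorization, by means
    of an arbitrary representative. *)
Definition Fl_chart g0 : chart R[i] (set ('I_n -> A)) :=
  @Chart _ _ (subspace_type Nspace) (qF @` cell_at g0)
    (fun t => toN (ell p (g0^-1 * xget 0 [set g | unitsA g /\ qF g = t]) - 1))
    (fun x => qF (g0 * (1 + subspace_val x))).

Lemma Fl_chartE g0 g : g0 \is a GRing.unit -> cell_at g0 g ->
  chart_map (Fl_chart g0) (qF g) = toN (ell p (g0^-1 * g) - 1).
Proof.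
move=> u0 gW; have ug := cell_at_unit u0 gW; rewrite /Fl_chart [LHS]/=.
case: xgetP => [x _ [ux /esym qx]|/(_ g) []//].
have [k kD ->] := cell_at_class u0 gW ux qx.
by rewrite mulrA ellM.
Qed.

(** The translate of the big cell is a union of classes. *)
Lemma cell_at_saturated g0 : g0 \is a GRing.unit ->
  unitsA `&` qF @^-1` (qF @` cell_at g0) = cell_at g0.
Proof.
move=> u0; apply/seteqP; split=> [g [ug [h hW hg]]|g gW].
  have [k kD ->] := cell_at_class u0 hW ug hg.
  by rewrite /cell_at /= mulrA; apply: big_cellM.
by split; [exact: cell_at_unit gW|exists g].
Qed.

Lemma toN_val x : big_cell p x -> subspace_val (toN (ell p x - 1)) = ell p x - 1.
Proof. exact: ell_N. Qed.

Lemma subN_val (x : subspace_type Nspace) : pi_N p (subspace_val x) = subspace_val x.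
Proof. exact: fix_val. Qed.

Lemma open_N_cell : open [set x : subspace_type Nspace | big_cell p (1 + subspace_val x)].
Proof.
have sv : smooth [set: subspace_type Nspace] (fun x => 1 + subspace_val x).
  apply: smoothD; first by apply: smooth_cst; exact: openT.
  by apply: smooth_clinear; [exact: openT|exact: clinear_val].
have := smooth_preim sv (open_big_cell p).
by congr open; apply/seteqP; split=> [x []|x].
Qed.

Lemma N_cell_ell x : big_cell p x ->
  big_cell p (1 + subspace_val (toN (ell p x - 1))).
Proof. by move=> xW; rewrite toN_val// addrC subrK; exact: big_cell_ell. Qed.

Lemma Fl_chart_is_chart g0 : g0 \is a GRing.unit ->
  is_chart (qF @` unitsA) (Fl_chart g0).
Proof.
move=> u0; split=> [_ [g gW <-]||].
- by exists g => //; exact: cell_at_unit gW.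
- have -> : chart_map (Fl_chart g0) @` chart_dom (Fl_chart g0) =
     [set x : subspace_type Nspace | big_cell p (1 + subspace_val x)].
    apply/seteqP; split=> [_ [_ [g gW <-] <-]|x xW].
      by rewrite Fl_chartE//; exact: N_cell_ell.
    have xC : cell_at g0 (g0 * (1 + subspace_val x)).
      by rewrite /cell_at /= mulKr.
    exists (qF (g0 * (1 + subspace_val x))).
      by exists (g0 * (1 + subspace_val x)).
    rewrite Fl_chartE// mulKr//.
    have := ell_N_Delta p_flag (subN_val x) xW (Delta_inv1 p_flag).
    rewrite mulr1 => -[-> _]; by rewrite addrAC subrr add0r; exact: fix_projK.
  exact: open_N_cell.
move=> _ /set_mem [g gW <-]; rewrite Fl_chartE//= toN_val// [1 + _]addrC subrK.
exact: Fl_map_ell.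
Qed.

Lemma ell_beta x : big_cell p x -> ell p x * (beta p x)^-1 = x.
Proof.
move=> xW; have [ub _ _] := beta_inv p_flag xW.
by rewrite /ell mulrK.
Qed.

(** Over the domain of the chart the orbit map is, up to the diffeomorphism
    given by the block LU factorization, a product projection whose second
    factor is the isotropy group. *)
Lemma Fl_chart_submersion g0 : g0 \is a GRing.unit ->
  submersion (unitsA `&` qF @^-1` chart_dom (Fl_chart g0))
    (chart_map (Fl_chart g0) \o qF).
Proof.
move=> u0; rewrite cell_at_saturated//.
apply: (@submersion_eq _ _ _ _ (fun g => toN (ell p (g0^-1 * g) - 1))).
  by move=> g gW /=; rewrite -Fl_chartE.
move=> g gW.
pose N1 := [set x : subspace_type Nspace | big_cell p (1 + subspace_val x)].
pose phi h := (toN (ell p (g0^-1 * h) - 1), to_Delta p_flag (beta p (g0^-1 * h))^-1).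
pose psi (z : subspace_type Nspace * Delta_alg p) : A :=
  g0 * ((1 + subspace_val z.1) * Delta_val z.2).
(* [phi] is the block LU factorization of [g0^-1 * h], and [psi] multiplies
   the two factors. *)
have psiK x b : N1 x -> Delta_units b ->
    phi (psi (x, b)) = (x, b) /\ cell_at g0 (psi (x, b)).
  move=> xW /Delta_unitsE bD.
  have [E1 E2] := ell_N_Delta p_flag (subN_val x) xW bD.
  rewrite /phi /psi /cell_at /= mulKr// E1 E2 Delta_valK; split.
    by congr pair; rewrite addrAC subrr add0r; exact: fix_projK.
  exact: big_cellM.
have phi2 h : cell_at g0 h -> Delta_val (phi h).2 = (beta p (g0^-1 * h))^-1.
  by move=> hW; apply: to_DeltaK; have [] := beta_inv p_flag hW.
exists (Delta_alg p), (cell_at g0), N1, (@Delta_units _ _ _ p), phi, psi; split; split=> //.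
- exact: open_N_cell.
- exact: open_Delta_units.
- apply: smooth_pair.
    apply: (smooth_clinear_comp (f := fun h => ell p (g0^-1 * h) - 1)).
      exact: clinear_fix_proj.
    apply: smoothB; last by apply: smooth_cst; exact: open_cell_at.
    exact: (smooth_cell_at g0 (smooth_ell p)).
  apply: (smooth_clinear_comp (f := fun h => (beta p (g0^-1 * h))^-1)).
    exact: clinear_to_Delta.
  apply: smoothV; last exact: (smooth_cell_at g0 (smooth_beta_cell p)).
  by move=> h hW; have [] := beta_inv p_flag hW.
- have oU : open (N1 `*` @Delta_units _ _ _ p).
    by apply: open_prodT; [exact: open_N_cell|exact: open_Delta_units].
  apply: smoothM; first exact: smooth_cst.
  apply: smoothM.
    apply: smoothD; first exact: smooth_cst.
    apply: smooth_clinear => //.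
    exact: clinear_comp (clinear_val _) (clinear_fst _ _).
  apply: smooth_clinear => //.
  exact: clinear_comp (clinear_val _) (clinear_snd _ _).
- apply/seteqP; split=> [_ [h hW <-]|[x b] [/= xW bU]].
    split; first exact: N_cell_ell.
    by apply/Delta_unitsE; rewrite phi2//; apply: Delta_invV; exact: beta_inv.
  by have [E C] := psiK x b xW bU; exists (psi (x, b)).
- move=> h /set_mem hW; rewrite /psi phi2// /phi /= toN_val// [1 + _]addrC subrK.
  by rewrite ell_beta// mulVKr.
- move=> x b xW bU; have [E _] := psiK x b xW bU.
  by have /(congr1 fst) := E.
Qed.

Lemma Fl_manifold : is_banach_manifold (Fl p).
Proof.
apply: quotient_is_manifold; first exact: open_units.
  move=> g ug; exists (Fl_chart g); split.
  - exact: Fl_chart_is_chart.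
  - by exists g => //; rewrite /cell_at /= mulVr//; exact: big_cell1.
  - exact: Fl_chart_submersion.
move=> g h ug uh gh.
have hd x y : x \is a GRing.unit -> y \is a GRing.unit ->
    ~ Delta p (x^-1 * y) ->
    \forall z \near (x, y), ~ Delta p (z.1^-1 * z.2).
  move=> ux uy nD.
  have [i Di] : exists i, (1 - p i) * (x^-1 * y) * p i <> 0.
    by apply: contra_notP nD => /forallNP nD i; apply: contrapT; exact: nD.
  pose U := unitsA `*` [set: A].
  have oU : open U by apply: open_prodT; [exact: open_units|exact: openT].
  have sU : smooth U (fun z => (1 - p i) * (z.1^-1 * z.2) * p i).
    apply: smoothM; last exact: smooth_cst.
    apply: smoothM; first exact: smooth_cst.
    apply: smoothM; last by apply: smooth_clinear => //; exact: clinear_snd.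
    apply: smoothV; first by move=> z [].
    by apply: smooth_clinear => //; exact: clinear_fst.
  have Uxy : U (x, y) by [].
  have := cvgr_neq0 _ (smooth_continuous sU Uxy).
  move=> /(_ _ (introN eqP Di)); apply: filterS => z /eqP nz Dz.
  by apply: nz; exact: Dz.
(* The classes differ because [g^-1 * h] or its inverse is outside the closed
   set [Delta]; both conditions are stable under small changes. *)
have [D1|D1] := pselect (Delta p (g^-1 * h)); last first.
  apply: filterS (hd g h ug uh D1) => z nz uz1 uz2 /(Fl_mapP p_flag uz1 uz2).
  by case=> _ /nz.
have D2 : ~ Delta p (h^-1 * g).
  move=> D2; apply: gh; apply/(Fl_mapP p_flag ug uh); split=> //.
    by rewrite unitrMl ?unitrV.
  by rewrite invrM ?unitrV// invrK.
have := hd h g uh ug D2 => -[[S T] /= [hS gT] ST].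
exists (T, S) => // -[z1 z2] [/= Tz1 Sz2] uz1 uz2 /(Fl_mapP p_flag uz1 uz2).
case=> _ _; rewrite invrM ?unitrV// invrK.
exact: (ST (z2, z1)).
Qed.

End FlagManifold.

(** * The Stiefel bundle *)

Section Bundle.
Variables (R : realType) (A : banachAlgType R[i]) (n : nat) (p : 'I_n -> A).
Hypothesis n_ge1 : (1 <= n)%N.
Hypothesis p_flag : is_flag p.

Local Notation unitsA := (@units_set _ A).
Local Notation unitsD := (@Delta_units _ _ _ p).
Local Notation qF := (Fl_map p).
Local Notation pn := (flag_ext p n).
Local Notation coset := (@stab_coset _ A n p).
Local Notation toD := (to_Delta p_flag).
Implicit Types (g h k : A) (a b : Delta_alg p).

Lemma Delta_val_inj : injective (@Delta_val _ A n p).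
Proof. exact: val_inj. Qed.

Lemma pn_idem : pn * pn = pn.
Proof. by apply: flag_idem. Qed.

Lemma Delta_pn k : Delta p k -> pn * k * pn = k * pn.
Proof. by move=> /DeltaE ->. Qed.

Lemma Delta_flag_last : Delta p pn.
Proof. apply/DeltaE => s sn; rewrite flag_extM// (flag_extM p_flag (s := n))//.
by rewrite flag_extM ?geq_min ?sn// minnAC minnn minnC.
Qed.

(** The last idempotent alone determines the stabilizer. *)
Lemma stabP k : k \is a GRing.unit -> stab_units p k <-> k * pn = pn.
Proof.
move=> uk; split=> [[_ kp]|kpn].
  have last_lt : (n.-1 < n)%N by rewrite prednK.
  have -> : pn = p (Ordinal last_lt).
    by rewrite -flag_extE; congr (flag_ext p _); exact/esym/prednK.
  exact: kp.
split=> // i; have <- : pn * p i = p i.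
  by rewrite -flag_extE flag_extM// ?(minn_idPr (ltn_ord i))// ltnW// ltnS.
by rewrite mulrA kpn.
Qed.

Lemma stab_Delta k : stab_units p k -> Delta_inv p k.
Proof.
move=> [uk kp]; split=> // i.
  by rewrite -mulrA kp mulrBl mul1r; have [-> _ _] := p_flag; rewrite subrr.
rewrite -{2}(kp i) mulrA mulrVK// mulrBl mul1r.
by have [-> _ _] := p_flag; rewrite subrr.
Qed.

Lemma stab_ratio g h : g \is a GRing.unit -> h \is a GRing.unit ->
  g * pn = h * pn -> stab_units p (g^-1 * h).
Proof.
move=> ug uh gh; apply/stabP; first by rewrite unitrMl ?unitrV.
by rewrite -mulrA -gh mulKr.
Qed.

(** A coset of the stabilizer is determined by its common value at the last
    idempotent. *)
Lemma stab_cosetE a : unitsD a ->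
  coset a = [set g | g \is a GRing.unit /\ g * pn = Delta_val a * pn].
Proof.
move=> [ua _]; apply/seteqP; split=> [_ [k kS <-]|g [ug gE]].
  have [uk _] := kS; split; first by rewrite unitrMl.
  by rewrite -mulrA; have /stabP -> := kS.
exists ((Delta_val a)^-1 * g); last by rewrite mulVKr.
exact: stab_ratio.
Qed.

Lemma coset_eqP a b : unitsD a -> unitsD b ->
  coset a = coset b <-> Delta_val a * pn = Delta_val b * pn.
Proof.
move=> aU bU; rewrite !stab_cosetE//; split=> [ab|->//].
have [ua _] := aU.
have : [set g | g \is a GRing.unit /\ g * pn = Delta_val a * pn] (Delta_val a) by [].
by rewrite ab => -[].
Qed.

Lemma coset_get a : unitsD a -> xget 0 (coset a) * pn = Delta_val a * pn.
Proof.
move=> aU; rewrite stab_cosetE//; case: xgetP => [x _ []//|/(_ (Delta_val a))].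
by case; split=> //; case: aU.
Qed.

(** The multiplication of [Delta], which lifts that of the structure group. *)
Definition mulD a b := toD (Delta_val a * Delta_val b).
(** The inverse in [Delta]; only its values on [Delta_units] are meaningful. *)
Definition invD a := toD (Delta_val a)^-1.

Lemma mulD_val a b : Delta_val (mulD a b) = Delta_val a * Delta_val b.
Proof. by apply: to_DeltaK; apply: DeltaM; exact: DeltaP_val. Qed.

Lemma invD_val a : unitsD a -> Delta_val (invD a) = (Delta_val a)^-1.
Proof. by move=> [_ Da]; exact: to_DeltaK. Qed.

Lemma toD_unit k : Delta_inv p k -> Delta_val (toD k) = k /\ unitsD (toD k).
Proof.
move=> kD; have kE : Delta_val (toD k) = k by apply: to_DeltaK; case: kD.
by split=> //; apply/Delta_unitsE; rewrite kE.
Qed.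

Lemma unitsD_inv a : unitsD a -> Delta_inv p (Delta_val a).
Proof. by move=> /Delta_unitsE. Qed.

Lemma unitsD_unit a : unitsD a -> Delta_val a \is a GRing.unit.
Proof. by case. Qed.

Lemma mulD_unit a b : unitsD a -> unitsD b -> unitsD (mulD a b).
Proof.
move=> aU bU; apply/Delta_unitsE; rewrite mulD_val.
by apply: Delta_invM; exact: unitsD_inv.
Qed.

Lemma invD_unit a : unitsD a -> unitsD (invD a).
Proof.
move=> aU; apply/Delta_unitsE; rewrite invD_val//.
by apply: Delta_invV; exact: unitsD_inv.
Qed.

Lemma cosetM a b : unitsD a -> unitsD b ->
  set_mul (coset a) (coset b) = coset (mulD a b).
Proof.
move=> aU bU; rewrite !stab_cosetE//; last exact: mulD_unit.
rewrite mulD_val; apply/seteqP; split.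
  move=> _ [x [ux xE] [y [uy yE] <-]]; split; first by rewrite unitrMl.
  have Db := Delta_pn (DeltaP_val b).
  have xyE : x * y * pn = x * (pn * Delta_val b * pn) by rewrite -mulrA yE Db.
  by rewrite xyE !mulrA xE -!mulrA (mulrA pn) Db.
move=> z [uz zE]; exists (Delta_val a); first by split=> //; exact: unitsD_unit.
have ua := unitsD_unit aU.
exists ((Delta_val a)^-1 * z); last by rewrite mulVKr.
by split; [rewrite unitrMl ?unitrV|rewrite -mulrA zE -mulrA mulKr].
Qed.

Lemma cosetV a : unitsD a -> set_inv (coset a) = coset (invD a).
Proof.
have key b x : unitsD b -> x \is a GRing.unit -> x * pn = Delta_val b * pn ->
    x^-1 * pn = (Delta_val b)^-1 * pn.
  move=> bU ux xE; have [ub _ Db'] := unitsD_inv bU.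
  have Dpn := Delta_pn Db'.
  have E : x * ((Delta_val b)^-1 * pn) = pn.
    by rewrite -Dpn !mulrA xE -2!mulrA (mulrA pn) Dpn mulVKr.
  by rewrite -[in LHS]E mulKr.
move=> aU; rewrite !stab_cosetE//; last exact: invD_unit.
rewrite invD_val//; apply/seteqP; split.
  by move=> _ [x [ux xE] <-]; split; [rewrite unitrV|exact: key].
move=> z [uz zE]; exists z^-1; last by rewrite invrK.
split; first by rewrite unitrV.
rewrite -invD_val// in zE.
by rewrite (key _ _ (invD_unit aU) uz zE) invD_val// invrK.
Qed.

(** The unit of [Delta]. *)
Definition oneD := toD 1.

Lemma oneD_val : Delta_val oneD = 1 /\ unitsD oneD.
Proof. by apply: toD_unit; exact: Delta_inv1. Qed.

Lemma coset1 : coset oneD = stab_units p.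
Proof.
have [E U] := oneD_val; rewrite stab_cosetE// E mul1r.
apply/seteqP; split=> [g [ug /stabP]|g gS]; first by apply.
by have [ug _] := gS; split=> //; apply/stabP.
Qed.

(** Right multiplication by the last idempotent, as a projection of [Delta]. *)
Definition rhoD a := toD (Delta_val a * pn).

Lemma rhoD_val a : Delta_val (rhoD a) = Delta_val a * pn.
Proof.
by apply: to_DeltaK; apply: DeltaM; [exact: DeltaP_val|exact: Delta_flag_last].
Qed.

Lemma rhoD_clinear : clinear rhoD.
Proof.
apply: (clinear_comp (clinear_to_Delta p_flag) (f := fun a => Delta_val a * pn)).
exact: (clinear_comp (clinear_mulr pn) (clinear_val _)).
Qed.

Lemma rhoD_idem a : rhoD (rhoD a) = rhoD a.
Proof. by apply: Delta_val_inj; rewrite !rhoD_val -mulrA pn_idem. Qed.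

Lemma group_manifold : is_banach_manifold (structure_group p).
Proof.
apply: (linear_quotient_manifold rhoD_clinear rhoD_idem).
  exact: open_Delta_units.
move=> a b aU bU; apply: iff_trans (coset_eqP aU bU) _; split=> ab.
  by apply: Delta_val_inj; rewrite !rhoD_val.
by rewrite -!rhoD_val ab.
Qed.

Lemma Stiefel_manifold : is_banach_manifold (Stiefel p).
Proof.
apply: (linear_quotient_manifold (clinear_mulr pn)) => //.
  by move=> x; rewrite -mulrA pn_idem.
exact: open_units.
Qed.

Let covS : covered (Stiefel p) unitsA (fun g => g * pn) :=
  covered_quotient _ (@open_units _ A).
Let covF : covered (Fl p) unitsA qF := covered_quotient _ (@open_units _ A).
Let covG : covered (structure_group p) unitsD coset :=
  covered_quotient _ (open_Delta_units p_flag).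

Lemma smooth_Delta_val (U : set (Delta_alg p)) : open U ->
  smooth U (@Delta_val _ _ _ p).
Proof. by move=> oU; apply: smooth_clinear => //; exact: clinear_val. Qed.

Lemma smooth_toD (E : normedModType R[i]) (U : set E) (f : E -> A) :
  smooth U f -> smooth U (fun x => toD (f x)).
Proof. by apply: (smooth_clinear_comp (f := f)); exact: clinear_to_Delta. Qed.

(** The cosets multiply and invert elementwise ([cosetM], [cosetV]), and the
    lifts of these operations to [Delta] are smooth. *)
Lemma structure_group_lie :
  is_banach_lie_group (structure_group p) (@set_mul _ A) (@set_inv _ A)
    (stab_units p).
Proof.
have oD := open_Delta_units p_flag; have [E1 U1] := oneD_val.
split.
- exact: group_manifold.
- by exists oneD => //; exact: coset1.
- move=> _ _ _ [a aU <-] [b bU <-] [c cU <-].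
  rewrite !cosetM//; try exact: mulD_unit.
  by congr coset; apply: Delta_val_inj; rewrite !mulD_val mulrA.
- move=> _ [a aU <-]; rewrite -coset1 !cosetM//.
  by split; congr coset; apply: Delta_val_inj; rewrite mulD_val E1
    ?mul1r ?mulr1.
- move=> _ [a aU <-]; have ua := unitsD_unit aU.
  rewrite cosetV// !cosetM//; try exact: invD_unit.
  rewrite -coset1; split; congr coset; apply: Delta_val_inj;
    by rewrite mulD_val E1 invD_val// ?mulVr ?mulrV.
- apply: (lift_msmooth_total (F := fun z => mulD z.1 z.2) (covered_prod covG covG) covG).
    have oDD : open (unitsD `*` unitsD) by exact: open_prodT.
    apply: smooth_toD; apply: smoothM.
      by apply: smooth_clinear => //; exact: clinear_comp (clinear_val _) (clinear_fst _ _).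
    by apply: smooth_clinear => //; exact: clinear_comp (clinear_val _) (clinear_snd _ _).
  by move=> [a b] [/= aU bU]; split; [exact: mulD_unit|rewrite cosetM].
- apply: (lift_msmooth_total (F := invD) covG covG).
    apply: smooth_toD; apply: smoothV; first by move=> a; exact: unitsD_unit.
    exact: smooth_Delta_val.
  by move=> a aU; split; [exact: invD_unit|rewrite cosetV].
Qed.

(** An arbitrary unit over a point of the Stiefel manifold, and 0 elsewhere;
    two such units differ by an element of the stabilizer ([repP]). *)
Definition rep (y : A) : A := xget 0 [set g | g \is a GRing.unit /\ g * pn = y].

(** The projection of the Stiefel bundle: [g p_n] is sent to the class of the
    conjugate of the flag by [g] ([sigmaE]). *)
Definition sigma (y : A) : set ('I_n -> A) := qF (rep y).

(** The action of the structure group: [y] is multiplied by an arbitrary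
    element of the coset [X].  The last factor makes the result independent of
    that choice. *)
Definition act (y : A) (X : set A) : A := y * xget 0 X * pn.

Lemma Fl_mapM g k : g \is a GRing.unit -> Delta_inv p k -> qF (g * k) = qF g.
Proof.
move=> ug kD; have [uk _ _] := kD; apply/Fl_mapP => //; first by rewrite unitrMl.
by rewrite invrM// mulrVK//; exact: Delta_invV.
Qed.

Lemma repP g : g \is a GRing.unit ->
  exists2 k, stab_units p k & rep (g * pn) = g * k.
Proof.
move=> ug; rewrite /rep; case: xgetP => [x _ [ux xE]|/(_ g) []//].
by exists (g^-1 * x); [exact: stab_ratio|rewrite mulVKr].
Qed.

Lemma sigmaE g : g \is a GRing.unit -> sigma (g * pn) = qF g.
Proof.
move=> ug; rewrite /sigma; have [k /stab_Delta kD ->] := repP ug.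
exact: Fl_mapM.
Qed.

Lemma actE g a : unitsD a -> act (g * pn) (coset a) = g * Delta_val a * pn.
Proof.
move=> aU; rewrite /act -mulrA coset_get// -mulrA (mulrA pn).
by rewrite Delta_pn ?mulrA//; exact: DeltaP_val.
Qed.

(** The orbits of the structure group are the fibers of [sigma]. *)
Lemma act_orbit g : g \is a GRing.unit ->
  [set act (g * pn) X | X in carrier (structure_group p)] =
  carrier (Stiefel p) `&` sigma @^-1` [set qF g].
Proof.
move=> ug; apply/seteqP; split=> [_ [_ [a aU <-] <-]|_ [[h uh <-] /=]].
  have uga : g * Delta_val a \is a GRing.unit by rewrite unitrMl ?unitsD_unit.
  rewrite actE//; split; first by exists (g * Delta_val a).
  by rewrite /preimage /= sigmaE// Fl_mapM//; exact: unitsD_inv.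
rewrite /preimage /= sigmaE// => /esym /(Fl_mapP p_flag ug uh) kD.
have [kE kU] := toD_unit kD; exists (coset (toD (g^-1 * h))).
  by exists (toD (g^-1 * h)).
by rewrite actE// kE mulVKr.
Qed.

Section Trivialization.
Variable g0 : A.
Hypothesis u0 : g0 \is a GRing.unit.

Local Notation cell := (cell_at p g0).

(** The component of [g] in [Delta] relative to the local section [sec]: one
    has [g = sec g * tau g] ([sec_tau]). *)
Definition tau g := toD (beta p (g0^-1 * g))^-1.
(** The lower factor of [g], translated back by [g0].  It depends only on the
    class of [g] ([secM]) and is a representative of it ([Fl_map_ell]), hence a
    local section of the orbit map. *)
Definition sec g := g0 * ell p (g0^-1 * g).

(** The local trivialization, computed from an arbitrary unit over [y]. *)
Definition triv (y : A) : set ('I_n -> A) * set A :=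
  (qF (rep y), coset (tau (rep y))).

(** The inverse of the trivialization: the coset [z.2] acts on the value of
    the local section at [z.1]. *)
Definition triv_inv (z : set ('I_n -> A) * set A) : A :=
  act (sec (xget 0 [set g | g \is a GRing.unit /\ qF g = z.1]) * pn) z.2.

Lemma cellM g k : cell g -> Delta_inv p k -> cell (g * k).
Proof. by move=> gC kD; rewrite /cell_at /= mulrA; exact: big_cellM. Qed.

Lemma tauP g : cell g ->
  Delta_val (tau g) = (beta p (g0^-1 * g))^-1 /\ unitsD (tau g).
Proof. by move=> gC; apply: toD_unit; apply: Delta_invV; exact: beta_inv. Qed.

Lemma tauM g k : cell g -> Delta_inv p k ->
  Delta_val (tau (g * k)) = Delta_val (tau g) * k.
Proof.
move=> gC kD; have [-> _] := tauP (cellM gC kD); have [-> _] := tauP gC.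
have [uk _ _] := kD; have [ub _ _] := beta_inv p_flag gC; have [ug _] := gC.
by rewrite (mulrA _ g) betaM// invrM ?unitrV// invrK.
Qed.

Lemma secM g k : cell g -> Delta_inv p k -> sec (g * k) = sec g.
Proof. by move=> gC kD; rewrite /sec (mulrA _ g) ellM. Qed.

Lemma sec_tau g : cell g -> sec g * Delta_val (tau g) = g.
Proof.
move=> gC; have [-> _] := tauP gC.
by rewrite /sec -mulrA ell_beta// mulVKr.
Qed.

Lemma sec_cell g : cell g -> cell (sec g) /\ Delta_val (tau (sec g)) = 1.
Proof.
move=> gC; have [E U] := tauP gC; have uU := unitsD_unit U.
have secE : sec g = g * (Delta_val (tau g))^-1 
    by apply: (mulIr uU); rewrite sec_tau// mulrVK.
have kD := Delta_invV (unitsD_inv U).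
by rewrite secE tauM// mulrV//; split=> //; exact: cellM.
Qed.

Lemma triv_class g k : cell g -> stab_units p k ->
  (qF (g * k), coset (tau (g * k))) = (qF g, coset (tau g)).
Proof.
move=> gC kS; have kD := stab_Delta kS; have ug := cell_at_unit u0 gC.
rewrite Fl_mapM//; congr pair.
apply/coset_eqP; [exact: (tauP (cellM gC kD)).2|exact: (tauP gC).2|].
rewrite tauM// -mulrA; congr (_ * _).
by apply/stabP => //; case: kS.
Qed.

Lemma trivE g : cell g -> triv (g * pn) = (qF g, coset (tau g)).
Proof.
move=> gC; have ug := cell_at_unit u0 gC.
by have [k kS kE] := repP ug; rewrite /triv kE; exact: triv_class.
Qed.

Lemma sec_rep g : cell g ->
  sec (xget 0 [set h | h \is a GRing.unit /\ qF h = qF g]) = sec g.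
Proof.
move=> gC; have ug := cell_at_unit u0 gC.
case: xgetP => [x _ [ux /esym qx]|/(_ g) []//].
by have [k kD ->] := cell_at_class p_flag u0 gC ux qx; exact: secM.
Qed.

Lemma triv_invE g a : cell g -> unitsD a ->
  triv_inv (qF g, coset a) = sec g * Delta_val a * pn.
Proof. by move=> gC aU; rewrite /triv_inv sec_rep// actE. Qed.

Local Notation piV :=
  (carrier (Stiefel p) `&` sigma @^-1` (qF @` cell)).

(** The part of the Stiefel manifold over the class of the translated cell. *)
Lemma piVP y : piV y <-> exists2 g, cell g & y = g * pn.
Proof.
split=> [[[g ug <-]]|[g gC ->]].
  rewrite /preimage /= sigmaE// => -[h hC hg].
  have [k kD ->] := cell_at_class p_flag u0 hC ug hg.
  by exists (h * k) => //; exact: cellM.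
have ug := cell_at_unit u0 gC; split; first by exists g.
by rewrite /preimage /= sigmaE//; exists g.
Qed.

Lemma cell_preim : unitsA `&` (fun g => g * pn) @^-1` piV = cell.
Proof.
apply/seteqP; split=> [g [ug]|g gC]; last first.
  by split; [exact: cell_at_unit gC|apply/piVP; exists g].
rewrite /preimage /= => /piVP [h hC hg].
have uh := cell_at_unit u0 hC.
have kD := stab_Delta (stab_ratio uh ug (esym hg)).
by rewrite -[g](mulVKr uh); exact: cellM.
Qed.

Lemma smooth_tau : smooth cell tau.
Proof.
apply: smooth_toD; apply: smoothV.
  by move=> g gC; have [] := beta_inv p_flag gC.
exact: (smooth_cell_at g0 (smooth_beta_cell p)).
Qed.

Lemma smooth_sec : smooth cell sec.
Proof.
apply: smoothM; first by apply: smooth_cst; exact: open_cell_at.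
exact: (smooth_cell_at g0 (smooth_ell p)).
Qed.

Lemma triv_smooth :
  msmooth_on (Stiefel p) (prod_manifold (Fl p) (structure_group p)) piV triv.
Proof.
apply: (lift_msmooth (F := fun g => (g, tau g)) covS (covered_prod covF covG)).
- by move=> y [].
- rewrite cell_preim; apply: smooth_pair; last exact: smooth_tau.
  by apply: smooth_id; exact: open_cell_at.
move=> g ug Vg; have gC : cell g by rewrite -cell_preim; split.
by rewrite trivE//=; split=> //; split=> //; exact: (tauP gC).2.
Qed.

Lemma sec_mul_cell g a : cell g -> unitsD a -> cell (sec g * Delta_val a).
Proof. by move=> gC aU; apply: cellM (unitsD_inv aU); exact: (sec_cell gC).1. Qed.

Lemma triv_inv_smooth :
  msmooth_on (prod_manifold (Fl p) (structure_group p)) (Stiefel p)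
    ((qF @` cell) `*` carrier (structure_group p)) triv_inv.
Proof.
have pre : (unitsA `*` unitsD) `&` (fun z => (qF z.1, coset z.2)) @^-1`
    ((qF @` cell) `*` carrier (structure_group p)) = cell `*` unitsD.
  have sat := cell_at_saturated p_flag u0.
  apply/seteqP; split=> [[g a] [[/= ug aU] [/= Vg _]]|[g a] [/= gC aU]].
    by split=> //=; rewrite -sat.
  have ug := cell_at_unit u0 gC; split; first by split.
  by split; [exists g|exists a].
apply: (lift_msmooth (F := fun z => sec z.1 * Delta_val z.2)
  (covered_prod covF covG) covS).
- move=> [_ X] [/= [g gC <-] ?]; split=> //.
  by exists g => //; exact: cell_at_unit gC.
- rewrite pre; have oC : open (cell `*` unitsD).
    apply: open_prodT; [exact: open_cell_at|exact: open_Delta_units].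
  apply: smoothM.
    apply: (smooth_comp (f := fst) _ smooth_sec) => [z []//|].
    by apply: smooth_clinear => //; exact: clinear_fst.
  apply: smooth_clinear => //.
  exact: (clinear_comp (clinear_val _) (clinear_snd _ _)).
move=> z zO zD; have : (cell `*` unitsD) z by rewrite -pre; split.
move: z {zO zD} => [g a] [/= gC aU]; rewrite triv_invE//; split=> //.
by apply: cell_at_unit (sec_mul_cell gC aU).
Qed.

Lemma sec_mul_triv g a : cell g -> unitsD a ->
  triv (sec g * Delta_val a * pn) = (qF g, coset a).
Proof.
move=> gC aU; have aD := unitsD_inv aU; have [sC tE] := sec_cell gC.
rewrite trivE; last exact: sec_mul_cell.
rewrite Fl_mapM//; last exact: cell_at_unit sC.
rewrite Fl_map_ell//; congr pair; congr coset; apply: Delta_val_inj.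
by rewrite tauM// tE mul1r.
Qed.

Lemma local_triviality : exists (V : set (set ('I_n -> A)))
    (Phi : A -> set ('I_n -> A) * set A) (Psi : set ('I_n -> A) * set A -> A),
  let piV := carrier (Stiefel p) `&` sigma @^-1` V in
  [/\ mopen (Fl p) V, V (qF g0) &
  [/\ msmooth_on (Stiefel p) (prod_manifold (Fl p) (structure_group p)) piV Phi,
      msmooth_on (prod_manifold (Fl p) (structure_group p)) (Stiefel p)
        (V `*` carrier (structure_group p)) Psi,
      Phi @` piV = V `*` carrier (structure_group p),
      {in piV, cancel Phi Psi} &
      (forall x, piV x -> (Phi x).1 = sigma x) /\
      forall x X, piV x -> carrier (structure_group p) X ->
        Phi (act x X) = ((Phi x).1, set_mul (Phi x).2 X)]].
Proof.
exists (qF @` cell), triv, triv_inv; split.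
- apply: (mopen_image covF); first exact: open_cell_at.
  by move=> g gC; exact: cell_at_unit gC.
- by exists g0 => //; rewrite /cell_at /= mulVr//; exact: big_cell1.
split.
- exact: triv_smooth.
- exact: triv_inv_smooth.
- apply/seteqP; split=> [_ [y /piVP [g gC ->] <-]|[_ _] [/= [g gC <-] [a aU <-]]].
    by rewrite trivE//; split; [exists g|exists (tau g) => //; exact: (tauP gC).2].
  exists (sec g * Delta_val a * pn); last exact: sec_mul_triv.
  by apply/piVP; exists (sec g * Delta_val a) => //; exact: sec_mul_cell.
- move=> _ /set_mem /piVP [g gC ->]; rewrite trivE// triv_invE//.
    by rewrite sec_tau.
  exact: (tauP gC).2.
split=> [_ /piVP [g gC ->]|_ _ /piVP [g gC ->] [a aU <-]].
  by rewrite trivE// sigmaE//; exact: cell_at_unit gC.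
have aD := unitsD_inv aU; have ug := cell_at_unit u0 gC.
have [_ tU] := tauP gC.
rewrite actE// !trivE//; last exact: cellM.
rewrite Fl_mapM//= cosetM//; congr pair; congr coset; apply: Delta_val_inj.
by rewrite tauM// mulD_val.
Qed.

End Trivialization.

Lemma Stiefel_bundle :
  is_principal_bundle (Stiefel p) (Fl p) sigma
    (structure_group p) (@set_mul _ A) (@set_inv _ A) (stab_units p) act.
Proof.
have [E1 U1] := oneD_val; split.
- exact: Stiefel_manifold.
- exact: Fl_manifold.
- exact: structure_group_lie.
- apply: (lift_msmooth_total (F := id) covS covF).
    by apply: smooth_id; exact: open_units.
  by move=> g ug; rewrite sigmaE.
- apply: (lift_msmooth_total
    (F := fun z : A * Delta_alg p => z.1 * Delta_val z.2)
    (covered_prod covS covG) covS).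
    have oUD : open (unitsA `*` unitsD).
      by apply: open_prodT; [exact: open_units|exact: open_Delta_units].
    apply: smoothM; first by apply: smooth_clinear => //; exact: clinear_fst.
    apply: smooth_clinear => //.
    exact: (clinear_comp (clinear_val _) (clinear_snd _ _)).
  move=> [g a] [/= ug aU]; rewrite actE//; split=> //.
  by rewrite /units_set /= unitrMl ?unitsD_unit.
- by move=> _ [g ug <-]; rewrite -coset1 actE// E1 mulr1.
- move=> _ _ _ [g ug <-] [a aU <-] [b bU <-].
  rewrite cosetM// !actE//; last exact: mulD_unit.
  by rewrite mulD_val mulrA.
- move=> _ _ [g ug <-] [a aU <-]; rewrite actE// -mulrA => /(mulrI ug) aE.
  by rewrite -coset1; apply/coset_eqP; rewrite // E1 mul1r.
- apply/seteqP; split=> [_ [_ [g ug <-] <-]|_ [_ [g ug <-] <-]].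
    by exists (qF g); [exists g|rewrite -act_orbit].
  by exists (g * pn); [exists g|rewrite act_orbit].
- by move=> _ [g ug <-]; exact: local_triviality.
Qed.

End Bundle.

Theorem proposition3p9 (R : realType) (A : banachAlgType R[i])
    (star : A -> A) (star_invol : is_involution star)
    (star_cont : continuous star) (A_herm : is_hermitian star)
    (n : nat) (n_ge1 : (1 <= n)%N) (p : 'I_n -> A) (p_flag : is_flag p) :
  exists (sigma : A -> set ('I_n -> A)) (act : A -> set A -> A),
    [/\ forall g : A, g \is a GRing.unit ->
          sigma (g * flag_ext p n) = flag_class (flag_conj p g),
        forall (g : A) (a : Delta_alg p),
          g \is a GRing.unit -> Delta_units a ->
          act (g * flag_ext p n) (stab_coset a) =
            g * Delta_val a * flag_ext p n &
        is_principal_bundle (Stiefel p) (Fl p) sigma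
          (structure_group p) (@set_mul _ A) (@set_inv _ A) (stab_units p)
          act].
Proof.
exists (@sigma R A n p), (@act R A n p); split.
- by move=> g ug; exact: sigmaE.
- by move=> g a _ aU; exact: actE.
- exact: Stiefel_bundle.
Qed.
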